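(* Let $N\geq 5$ and let $B$ be the unit ball in $\mathbb{R}^N$. Then for all $u\in C_0^\infty(B)$, \[ \int_B|\Delta u|^2\,dx\;\geq\;\frac{(N-2)^2(N-4)^2}{16}\int_B\frac{u^2}{\big(|x|^2-\tfrac{9}{10}|x|^{\frac N2+1}\big)\big(|x|^2-|x|^{\frac N2}\big)}\,dx+\frac{(N-1)(N-4)^2}{4}\int_B\frac{u^2}{|x|^2\big(|x|^2-|x|^{\frac N2}\big)}\,dx. \] Consequently, for all $u\in C_0^\infty(B)$, \[ \int_B|\Delta u|^2\,dx\;\geq\;\frac{N^2(N-4)^2}{16}\int_B\frac{u^2}{|x|^2\big(|x|^2-|x|^{\frac N2}\big)}\,dx. \] *)

(* Defs.v *)
From HB Require Import structures.
From mathcomp Require Import all_boot all_order all_algebra.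
From mathcomp Require Import all_classical all_reals all_analysis.
Set Implicit Arguments. Unset Strict Implicit. Unset Printing Implicit Defensive.
Import Order.TTheory GRing.Theory Num.Theory.
Import numFieldNormedType.Exports.
Local Open Scope ring_scope.
Local Open Scope classical_set_scope.

(* Euclidean norm |x| on R^N (the library norm on 'rV is the sup norm). *)
Definition enorm (R : realType) (N : nat) (x : 'rV[R]_N) : R :=
  Num.sqrt (\sum_(i < N) x ord0 i ^+ 2).

Definition ebasis (R : realType) (N : nat) (i : 'I_N) : 'rV[R]_N :=
  delta_mx ord0 i.

Definition Dlist (R : realType) (N : nat) (s : seq 'rV[R]_N)
  (f : 'rV[R]_N -> R) : 'rV[R]_N -> R :=
  foldr (fun v g => 'D_v g) f s.

Definition smooth (R : realType) (N : nat) (f : 'rV[R]_N -> R) : Prop :=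
  forall s : seq 'rV[R]_N,
    continuous (Dlist s f) /\ forall x v, derivable (Dlist s f) x v.

Definition Cc_inf_unit_ball (R : realType) (N : nat) (u : 'rV[R]_N -> R)
  : Prop :=
  smooth u /\ exists r : R, r < 1 /\ forall x, r <= enorm x -> u x = 0.

Definition laplacian (R : realType) (N : nat) (u : 'rV[R]_N -> R)
  : 'rV[R]_N -> R :=
  fun x => \sum_(i < N) 'D_(ebasis R i) ('D_(ebasis R i) u) x.

(* Lebesgue integral over R^N of an extended-real valued (nonnegative)
   function, as the iterated one-dimensional Lebesgue integral
   (equal to the N-dimensional Lebesgue integral by Tonelli). *)
Fixpoint integralRN (R : realType) (n : nat) :
  ('rV[R]_n -> \bar R) -> \bar R :=
  match n with
  | 0 => fun f => f 0
  | n'.+1 => fun f =>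
      (\int[@lebesgue_measure R]_(t in setT)
         integralRN (fun v : 'rV[R]_n' => f (row_mx (\row_(j < 1) t) v)))%E
  end.

Definition integral_B (R : realType) (N : nat) (g : 'rV[R]_N -> R) : \bar R :=
  integralRN (fun x => if enorm x < 1 then (g x)%:E else 0%E).

(* Main.v *)
(* Put [r = |x|], [E = x . grad], [L_ij = x_i d_j - x_j d_i], [g = E u] and
   [A = E g + (N - 2) g]. Then [r^2 Lap u = A + S] with [S = 1/2 sum L_ij L_ij u], so
   [(Lap u)^2 >= r^-4 (A^2 + 2 A S)]. Since [L_ij] commutes with [E], integrating by
   parts along [L_ij] and then along [E] turns [r^-4 2 A S] into the nonnegative
   [r^-4 sum ((E v_ij)^2 + (N - 4) v_ij^2)], where [v_ij = L_ij u]; only the radial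
   part [r^-4 A^2] remains.

   With [m = N/2 - 1], [p = N/2 - 2], the functions [mu = m / (1 - 9/10 r^m)] and
   [nu = p / (1 - r^p)] solve the Riccati equations [E mu = mu^2 - m mu] and
   [E nu = nu^2 - p nu]. Hence [(E g + (mu - 1) g)^2 >= 0] and [(g + nu u)^2 >= 0]
   give, after integration by parts along [E],
   [int r^-4 A^2 >= int r^-4 (N - 1 + m mu) g^2
                 >= int r^-4 p nu (N - 1 + m mu) u^2],
   and the last weight is the sum of the two weights of the first inequality. The
   second inequality follows because [mu >= m] and [m^2 + N - 1 = N^2 / 4].

   The weights are singular at the origin, so they are multiplied by a radial cutoff
   at scale [1/k]. The derivative of the cutoff produces an error [O(k^(4 - N))], which
   tends to [0] since [N >= 5], and monotone convergence removes the cutoff. *)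

Require Import Defs.
From HB Require Import structures.
From mathcomp Require Import all_boot all_order all_algebra.
From mathcomp Require Import all_classical all_reals all_analysis.
Import Order.TTheory GRing.Theory Num.Theory.
Import numFieldNormedType.Exports.
Local Open Scope ring_scope.
From mathcomp Require Import ring lra.
Set Implicit Arguments.
Unset Strict Implicit.
Local Open Scope classical_set_scope.

(** * Iterated integrals of compactly supported functions *)

Section compactly_supported_integral.
Context {R : realType}.
Local Notation mu := (@lebesgue_measure R).

Definition vcons {n} (t : R) (v : 'rV[R]_n) : 'rV[R]_n.+1 :=
  row_mx (\row_(j < 1) t) v.

Lemma vcons0 n t (v : 'rV[R]_n) : vcons t v ord0 ord0 = t.
Proof.
by rewrite mxE; case: splitP => // j _; rewrite mxE.
Qed.

Lemma vcons_lift n t (v : 'rV[R]_n) j : vcons t v ord0 (lift ord0 j) = v ord0 j.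
Proof.
rewrite mxE; case: splitP => [i|i [ji]]; first by rewrite [i]ord1.
by congr (v _ _); apply/val_inj.
Qed.

Lemma vconsB n t t' (v v' : 'rV[R]_n) :
  vcons t v - vcons t' v' = vcons (t - t') (v - v').
Proof.
apply/rowP => i.
have subE m (A B : 'rV[R]_m) k : (A - B) ord0 k = A ord0 k - B ord0 k.
  by rewrite !mxE.
rewrite subE; case: (unliftP ord0 i) => [j ->|->].
  by rewrite !vcons_lift subE.
by rewrite !vcons0.
Qed.

Lemma ler_coord_norm n (x : 'rV[R]_n) j : `|x ord0 j| <= `|x|.
Proof.
rewrite [leRHS]mx_normrE; exact: (le_bigmax _ (fun i => `|x i.1 i.2|) (ord0, j)).
Qed.

Lemma ler_norm_coord n (x : 'rV[R]_n) c : 0 <= c ->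
  (forall j, `|x ord0 j| <= c) -> `|x| <= c.
Proof.
move=> c0 xc; rewrite [leLHS]mx_normrE.
by apply: bigmax_le => // -[i j] _ /=; rewrite ord1.
Qed.

Lemma norm_vcons n t (v : 'rV[R]_n) : `|vcons t v| = Num.max `|t| `|v|.
Proof.
apply/eqP; rewrite eq_le; apply/andP; split.
  apply: ler_norm_coord => [|j]; first by rewrite le_max normr_ge0.
  case: (unliftP ord0 j) => [i ->|->].
    by rewrite vcons_lift le_max ler_coord_norm orbT.
  by rewrite vcons0 le_max lexx.
rewrite ge_max; apply/andP; split.
  by rewrite -{1}(vcons0 t v) ler_coord_norm.
by apply: ler_norm_coord => // j; rewrite -(vcons_lift t) ler_coord_norm.
Qed.

(** One class, stable under slicing, on which iterated integrals are finite and linear. The modulus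
    of continuity is uniform so that it passes to the slice integrals as functions of the first
    variable. *)
Definition nice {n} (L : R) (f : 'rV[R]_n -> R) : Prop :=
  [/\ forall e : R, 0 < e -> exists2 d : R, 0 < d &
        forall x y : 'rV[R]_n, `|x - y| < d -> `|f x - f y| <= e,
      exists M : R, forall x, `|f x| <= M
    & forall x : 'rV[R]_n, L < `|x| -> f x = 0].

Lemma nice_slice n L (f : 'rV[R]_n.+1 -> R) t :
  nice L f -> nice L (fun v => f (vcons t v)).
Proof.
move=> [uf [M fM] sf]; split.
- move=> e /uf[d d0 fd]; exists d => // x y xy; apply: fd.
  by rewrite vconsB norm_vcons subrr normr0 max_r.
- by exists M.
- by move=> v Lv; apply: sf; rewrite norm_vcons lt_max Lv orbT.
Qed.

Lemma niceZD n L (f g : 'rV[R]_n -> R) a : nice L f -> nice L g ->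
  nice L (fun x => f x + a * g x).
Proof.
move=> [uf [M fM] sf] [ug [M' gM] sg]; split.
- move=> e e0.
  have [d d0 fd] := uf (e / 2) (divr_gt0 e0 (ltr0Sn _ _)).
  have a0 : 0 < `|a| + 1 by rewrite ltr_pwDr.
  have [d' d'0 gd] := ug (e / 2 / (`|a| + 1)) (divr_gt0 (divr_gt0 e0 (ltr0Sn _ _)) a0).
  exists (Num.min d d') => [|x y]; first by rewrite lt_min d0.
  rewrite lt_min => /andP[xd xd'].
  have -> : f x + a * g x - (f y + a * g y) = (f x - f y) + a * (g x - g y) by ring.
  rewrite (splitr e); apply: (le_trans (ler_normD _ _)).
  apply: lerD; first exact: fd.
  rewrite normrM; apply: (@le_trans _ _ ((`|a| + 1) * `|g x - g y|)).
    by apply: ler_wpM2r => //; rewrite lerDl.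
  by rewrite -ler_pdivlMl// mulrC; exact: gd.
- exists (M + `|a| * M') => x; apply: (le_trans (ler_normD _ _)).
  by apply: lerD => //; rewrite normrM; apply: ler_wpM2l.
- by move=> x Lx; rewrite sf// sg// mulr0 addr0.
Qed.

Lemma nice0 n L : nice L (fun _ : 'rV[R]_n => 0 : R).
Proof.
split=> // [e e0|]; first by exists 1 => // x y _; rewrite subrr normr0 ltW.
by exists 0 => x; rewrite normr0.
Qed.

(** Real-valued counterpart of [integralRN], on which ordinary linear arithmetic is available;
    [integralRN_EFin] and [integralRN_cvg] lead back to [integralRN]. *)
Fixpoint Ir n : ('rV[R]_n -> R) -> R :=
  match n with
  | 0 => fun f => f 0
  | n'.+1 => fun f => \int[mu]_t Ir (fun v : 'rV[R]_n' => f (vcons t v))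
  end.

Lemma Rintegral_supp L (g : R -> R) : (forall t, L < `|t| -> g t = 0) ->
  \int[mu]_t g t = \int[mu]_(t in `[- L, L]) g t.
Proof.
move=> sg; rewrite [RHS]Rintegral_mkcond; apply: eq_Rintegral => t _.
rewrite patchE; case: ifPn => // /negP; rewrite inE/= in_itv/= => tL.
by apply: sg; rewrite ltNge ler_norml; apply/negP.
Qed.

Lemma integrable_supp L (g : R -> R) : continuous g ->
  (forall t, L < `|t| -> g t = 0) -> mu.-integrable setT (EFin \o g).
Proof.
move=> cg sg.
have -> : EFin \o g = (EFin \o g) \_ `[- L, L].
  apply/funext => t /=; rewrite patchE; case: ifPn => // /negP.
  rewrite inE/= in_itv/= => tL.
  by congr EFin; apply: sg; rewrite ltNge ler_norml; apply/negP.
apply/integrable_restrict => //; rewrite setTI.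
apply: continuous_compact_integrable; first exact: segment_compact.
exact: continuous_subspaceT.
Qed.

Lemma uniform_continuous (g : R -> R) :
  (forall e : R, 0 < e -> exists2 d : R, 0 < d &
     forall x y : R, `|x - y| < d -> `|g x - g y| <= e) -> continuous g.
Proof.
move=> ug x; apply/cvgrPdist_le => e /ug[d d0 gd].
near=> y; apply: gd; near: y.
exact: cvgr_dist_lt.
Unshelve. all: by end_near. Qed.

(** Bound and linearity go through one induction on [n]: linearity in dimension [n.+1] needs
    integrable slice integrals, hence their continuity, which uses both properties in dimension
    [n]. *)
Definition Ir_ok n L : Prop :=
  (forall (f : 'rV[R]_n -> R) M, nice L f -> (forall x, `|f x| <= M) ->
     `|Ir f| <= M * (L *+ 2) ^+ n) /\
  (forall (f g : 'rV[R]_n -> R) a, nice L f -> nice L g ->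
     Ir (fun x => f x + a * g x) = Ir f + a * Ir g).

Lemma Ir_ok_slice n L (f : 'rV[R]_n.+1 -> R) : 0 <= L -> Ir_ok n L -> nice L f ->
  let g := fun t => Ir (fun v => f (vcons t v)) in
  continuous g /\ (forall t, L < `|t| -> g t = 0).
Proof.
move=> L0 [IHb IHl] nf g; split.
  apply: uniform_continuous => e e0.
  (* The summand [1] keeps the divisor positive when [L = 0]. *)
  have K0 : 0 < (L *+ 2) ^+ n + 1.
    by rewrite ltr_wpDl// exprn_ge0// mulrn_wge0.
  have [uf _ _] := nf.
  have [d d0 fd] := uf (e / ((L *+ 2) ^+ n + 1)) (divr_gt0 e0 K0).
  exists d => // t t' tt'.
  have -> : g t - g t' =
      Ir (fun v => f (vcons t v) + (-1) * f (vcons t' v)).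
    by rewrite IHl ?mulN1r//; exact: nice_slice.
  apply: (@le_trans _ _ (e / ((L *+ 2) ^+ n + 1) * (L *+ 2) ^+ n)).
    apply: IHb; first by apply: niceZD; exact: nice_slice.
    move=> v; rewrite mulN1r; apply: fd.
    by rewrite vconsB norm_vcons subrr normr0 max_l.
  rewrite -mulrA ler_piMr ?(ltW e0)// mulrC ler_pdivrMr// mul1r.
  by rewrite lerDl.
move=> t Lt; apply/eqP; rewrite -normr_le0 -(mul0r ((L *+ 2) ^+ n)).
apply: IHb; first exact: nice_slice.
move=> v; have [_ _ sf] := nf; rewrite sf ?normr0//.
by rewrite norm_vcons lt_max Lt.
Qed.

Lemma Ir_okP n L : 0 <= L -> Ir_ok n L.
Proof.
move=> L0; elim: n => [|n IH].
  by split => [f M _ fM|f g a _ _] /=; [rewrite expr0 mulr1|].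
have slice f nf := @Ir_ok_slice n L f L0 IH nf; case: IH => IHb IHl.
split.
  move=> f M nf fM /=; have [cg sg] := slice f nf.
  rewrite (Rintegral_supp sg).
  apply: (le_trans (le_normr_Rintegral _ _)) => //.
    apply: continuous_compact_integrable; first exact: segment_compact.
    exact: continuous_subspaceT.
  apply: (@le_trans _ _
      (\int[mu]_(t in `[- L, L]) cst (M * (L *+ 2) ^+ n) t)).
    apply: le_Rintegral => //.
    - apply: continuous_compact_integrable; first exact: segment_compact.
      apply: continuous_subspaceT => t.
      by apply: continuous_comp; [exact: cg|exact: norm_continuous].
    - apply: continuous_compact_integrable; first exact: segment_compact.
      by apply: continuous_subspaceT => t; exact: cst_continuous.
    - by move=> t _ /=; apply: IHb => //; exact: nice_slice.
  rewrite Rintegral_cst//= lebesgue_measure_itv/= lte_fin.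
  case: ifPn => LL /=.
    by rewrite opprK exprSr -mulr2n mulrA.
  by rewrite mulr0 mulr_ge0// ?exprn_ge0 ?mulrn_wge0// (le_trans _ (fM 0)).
move=> f g a nf ng /=.
have [cf sf] := slice f nf; have [cg sg] := slice g ng.
have if_ := integrable_supp cf sf; have ig := integrable_supp cg sg.
transitivity (\int[mu]_t (Ir (fun v => f (vcons t v)) +
                          a * Ir (fun v => g (vcons t v)))).
  by apply: eq_Rintegral => t _; apply: IHl; exact: nice_slice.
rewrite RintegralD// ?RintegralZl//.
apply: (@integrable_supp L).
  by move=> t; apply: cvgM; [exact: cvg_cst|exact: cg].
by move=> t /sg ->; rewrite mulr0.
Qed.

Lemma Ir_slice_continuous n L (f : 'rV[R]_n.+1 -> R) : 0 <= L -> nice L f ->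
  continuous (fun t => Ir (fun v => f (vcons t v))).
Proof. by move=> L0 nf; case: (Ir_ok_slice L0 (Ir_okP n L0) nf). Qed.

Lemma Ir_slice_supp n L (f : 'rV[R]_n.+1 -> R) t : 0 <= L -> nice L f ->
  L < `|t| -> Ir (fun v => f (vcons t v)) = 0.
Proof. by move=> L0 nf; case: (Ir_ok_slice L0 (Ir_okP n L0) nf) => _; apply. Qed.

(* The norm of ['rV[R]_n] is the sup norm, so that the support lies in a cube of
   volume [(2 L) ^ n]. *)
Lemma Ir_bound n L (f : 'rV[R]_n -> R) M : 0 <= L -> nice L f ->
  (forall x, `|f x| <= M) -> `|Ir f| <= M * (L *+ 2) ^+ n.
Proof. by move=> L0; exact: (Ir_okP n L0).1. Qed.

Lemma Ir_linear n L (f g : 'rV[R]_n -> R) a : 0 <= L -> nice L f -> nice L g ->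
  Ir (fun x => f x + a * g x) = Ir f + a * Ir g.
Proof. by move=> L0; exact: (Ir_okP n L0).2. Qed.

Lemma Ir0 n : Ir (fun _ : 'rV[R]_n => 0 : R) = 0.
Proof.
have := Ir_linear (-1) (lexx (0 : R)) (@nice0 n 0) (@nice0 n 0).
by under eq_fun do rewrite mulr0 addr0; lra.
Qed.

Lemma Ir_comb n L (f g : 'rV[R]_n -> R) a c : 0 <= L -> nice L f -> nice L g ->
  Ir (fun x => a * f x + c * g x) = a * Ir f + c * Ir g.
Proof.
move=> L0 nf ng.
have naf : nice L (fun x => a * f x).
  by under eq_fun do rewrite -[_ * _]add0r; apply: niceZD => //; exact: nice0.
rewrite (Ir_linear _ L0 naf ng); congr (_ + _).
under eq_fun do rewrite -[_ * _]add0r.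
by rewrite (Ir_linear _ L0 (@nice0 n L) nf) Ir0 add0r.
Qed.

Lemma Ir_ge0 n (f : 'rV[R]_n -> R) : (forall x, 0 <= f x) -> 0 <= Ir f.
Proof.
elim: n f => [|n IH] f f0 /=; first exact: f0.
by apply: Rintegral_ge0 => t _; apply: IH.
Qed.

Lemma Ir_le n L (f g : 'rV[R]_n -> R) : 0 <= L -> nice L f -> nice L g ->
  (forall x, f x <= g x) -> Ir f <= Ir g.
Proof.
move=> L0 nf ng fg; rewrite -subr_ge0 -mulN1r -(Ir_linear _ L0 ng nf).
by apply: Ir_ge0 => x; rewrite mulN1r subr_ge0.
Qed.

Lemma Ir_slice_integrable n L (f : 'rV[R]_n.+1 -> R) : 0 <= L -> nice L f ->
  mu.-integrable setT (fun t => (Ir (fun v => f (vcons t v)))%:E).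
Proof.
move=> L0 nf; apply: (@integrable_supp L); first exact: Ir_slice_continuous nf.
by move=> t; exact: Ir_slice_supp nf.
Qed.

Lemma Ir_integralE n L (f : 'rV[R]_n.+1 -> R) : 0 <= L -> nice L f ->
  (Ir f)%:E = (\int[mu]_(t in setT) (Ir (fun v => f (vcons t v)))%:E)%E.
Proof.
by move=> L0 nf /=; rewrite fineK//; apply: integrable_fin_num => //;
  exact: Ir_slice_integrable nf.
Qed.

(** One-dimensional monotone convergence, iterated: the inner integrals again form a nondecreasing
    sequence, measurable because slice integrals of [nice] functions are integrable. *)
Lemma integralRN_cvg n L (f : nat -> 'rV[R]_n -> R) (F : 'rV[R]_n -> \bar R) :
  0 <= L -> (forall k, nice L (f k)) -> (forall k x, 0 <= f k x) ->
  (forall x, nondecreasing_seq (f ^~ x)) ->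
  (forall x, (f k x)%:E @[k --> \oo] --> F x) ->
  (Ir (f k))%:E @[k --> \oo] --> integralRN F.
Proof.
elim: n f F => [|n IH] f F L0 nf f0 ndf fF; first exact: fF.
pose g k t := (Ir (fun v => f k (vcons t v)))%:E.
have gG t : g k t @[k --> \oo] --> integralRN (fun v => F (vcons t v)).
  by apply: IH => // k; exact: nice_slice.
have -> : (fun k => (Ir (f k))%:E) = (fun k => \int[mu]_(t in setT) g k t)%E.
  by apply/funext => k; rewrite (Ir_integralE L0 (nf k)).
have -> : integralRN F = (\int[mu]_(t in setT) limn (g ^~ t))%E.
  by apply: eq_integral => t _; apply/esym/cvg_lim => //; exact: gG.
apply: cvg_monotone_convergence => //.
- by move=> k; case/integrableP: (Ir_slice_integrable L0 (nf k)).
- by move=> k t _; rewrite lee_fin; apply: Ir_ge0.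
- move=> t _ j k jk; rewrite lee_fin; apply: (Ir_le L0) => [||v];
    [exact: nice_slice..|exact: ndf].
Qed.

Lemma integralRN_EFin n L (f : 'rV[R]_n -> R) : 0 <= L -> nice L f ->
  integralRN (fun x => (f x)%:E) = (Ir f)%:E.
Proof.
elim: n f => [//|n IH] f L0 nf; rewrite (Ir_integralE L0 nf).
by apply: eq_integral => t _; apply: IH => //; exact: nice_slice.
Qed.

(** * Differentiation under the integral and integrals of partial derivatives *)

Lemma is_derive_line n (f : 'rV[R]_n -> R) (a v : 'rV[R]_n) t d :
  is_derive (t *: v + a) v f d -> is_derive t 1 (fun h : R => f (h *: v + a)) d.
Proof.
suff E : (fun h : R => h^-1 *: ((f \o shift (t *: v + a)) (h *: v) - f (t *: v + a)))
  = (fun h : R => h^-1 *: (((fun h : R => f (h *: v + a)) \o shift t) (h *: 1)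
       - f (t *: v + a))).
  by case=> df <-; split; rewrite /derivable /derive -E.
apply/funext => h /=; congr (_ *: (f _ - _)).
by rewrite scalerDl [_%:A]mulr1 addrA.
Qed.

Lemma lincomb_coordE n h (A B : 'rV[R]_n) i :
  (h *: A + B) ord0 i = h * A ord0 i + B ord0 i.
Proof. by rewrite !mxE. Qed.

Lemma ebasisE n (i j : 'I_n) : ebasis R i ord0 j = (j == i)%:R.
Proof. by rewrite mxE. Qed.

Lemma vcons_ebasis0 n t h (v : 'rV[R]_n) :
  vcons (h + t) v = h *: ebasis R ord0 + vcons t v.
Proof.
apply/rowP => i; rewrite lincomb_coordE ebasisE.
case: (unliftP ord0 i) => [j ->|->]; last by rewrite !vcons0 mulr1.
by rewrite !vcons_lift mulr0 add0r.
Qed.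

Lemma vcons_ebasis n t h (v : 'rV[R]_n) j :
  vcons t (h *: ebasis R j + v) = h *: ebasis R (lift ord0 j) + vcons t v.
Proof.
apply/rowP => i; rewrite lincomb_coordE ebasisE.
case: (unliftP ord0 i) => [k ->|->].
  rewrite !vcons_lift lincomb_coordE ebasisE.
  by rewrite (inj_eq lift_inj).
by rewrite !vcons0 mulr0 add0r.
Qed.

Lemma is_derive_vcons n (f : 'rV[R]_n.+1 -> R) t v j d :
  is_derive (vcons t v) (ebasis R (lift ord0 j)) f d ->
  is_derive v (ebasis R j) (fun v => f (vcons t v)) d.
Proof.
suff E : (fun h : R => h^-1 *: ((f \o shift (vcons t v)) (h *: ebasis R (lift ord0 j))
         - f (vcons t v)))
  = (fun h : R => h^-1 *: (((fun v => f (vcons t v)) \o shift v) (h *: ebasis R j)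
       - f (vcons t v))).
  by case=> df <-; split; rewrite /derivable /derive -E.
by apply/funext => h /=; rewrite vcons_ebasis.
Qed.

(** By the mean value theorem each difference quotient is a value of [f'] at distance less than
    [|h|] from [t] in the first variable. Uniform continuity of [f'] makes the error small uniformly
    in [v], and [Ir_bound] integrates it. *)
Lemma is_derive_Ir n (L : R) (f f' : 'rV[R]_n.+1 -> R) (t : R) : 0 <= L ->
  nice L f -> nice L f' -> (forall x, is_derive x (ebasis R ord0) f (f' x)) ->
  is_derive t (1 : R) (fun t : R => Ir (fun v => f (vcons t v)))
    (Ir (fun v => f' (vcons t v))).
Proof.
move=> L0 nf nf' df.
have K0 : 0 < (L *+ 2) ^+ n + 1.
  by rewrite ltr_wpDl// exprn_ge0// mulrn_wge0.
set g := fun t => _; set g't := Ir _.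
have dfv v (s : R) : is_derive s (1 : R) (fun s : R => f (vcons s v)) (f' (vcons s v)).
  have E s' : vcons s' v = s' *: ebasis R ord0 + vcons 0 v.
    by rewrite -vcons_ebasis0 addr0.
  have -> : (fun s => f (vcons s v)) = (fun s => f (s *: ebasis R ord0 + vcons 0 v)).
    by apply/funext => s'; rewrite E.
  by apply: is_derive_line; rewrite -E; exact: df.
have lim : h^-1 *: ((g \o shift t) (h *: (1 : R)) - g t) @[h --> 0^'] --> g't.
  apply/cvgrPdist_le => e e0.
  have [uf' _ _] := nf'.
  have [d d0 fd] := uf' (e / ((L *+ 2) ^+ n + 1)) (divr_gt0 e0 K0).
  near=> h.
  have h0 : h != 0 by near: h; exact: nbhs_dnbhs_neq.
  have hd : `|h| < d.
    near: h; apply: dnbhs0_lt; exact: d0.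
  rewrite /= [h *: _]mulr1 -normrN opprB.
  have -> : h^-1 *: (g (h + t) - g t) - g't = h^-1 *
     (Ir (fun v => f (vcons (h + t) v) + (-1) * f (vcons t v) +
        (- h) * f' (vcons t v))).
    rewrite (@Ir_linear n L) ?(@Ir_linear n L)//; try by
      [exact: nice_slice|apply: niceZD; exact: nice_slice].
    by rewrite /g /g't /GRing.scale/=; field.
  rewrite normrM normfV mulrC ler_pdivrMr ?normr_gt0//.
  apply: (@le_trans _ _ ((e / ((L *+ 2) ^+ n + 1) * `|h|) * (L *+ 2) ^+ n)).
    apply: Ir_bound => //.
      by do 2?apply: niceZD; exact: nice_slice.
    move=> v.
    (* The mean value theorem on the segment between [t] and [h + t], with one case for each sign of
       [h]. *)
    have [s sh ->] : exists2 s, `|s - t| < d & f (vcons (h + t) v) +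
        -1 * f (vcons t v) = f' (vcons s v) * h.
      have cf a b : {within `[a, b], continuous (fun s => f (vcons s v))}.
        apply: derivable_within_continuous => s _; exact: ex_derive.
      have [hp|hn] := ltP 0 h.
        have tht : t < h + t by rewrite ltrDr.
        have [s] := MVT tht (fun s _ => dfv v s) (cf _ _).
        rewrite in_itv/= => /andP[ts sh] E; exists s.
          move: hd; rewrite gtr0_norm// => hd.
          by rewrite gtr0_norm ?subr_gt0//; lra.
        by rewrite mulN1r E; ring.
      have {}hn : h < 0 by rewrite lt_neqAle h0.
      have tht : h + t < t by rewrite gtrDr.
      have [s] := MVT tht (fun s _ => dfv v s) (cf _ _).
      rewrite in_itv/= => /andP[ts sh] E; exists s.
        move: hd; rewrite ltr0_norm// => hd.
        by rewrite ltr0_norm ?subr_lt0//; lra.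
      by rewrite mulN1r -opprB E; ring.
    rewrite mulNr [h * _]mulrC -mulrBl normrM; apply: ler_wpM2r => //.
    by apply: fd; rewrite vconsB norm_vcons subrr normr0 max_l.
  rewrite mulrAC ler_wpM2r//.
  rewrite -mulrA ler_piMr ?(ltW e0)// mulrC ler_pdivrMr// mul1r.
  by rewrite lerDl.
split; first by apply/cvg_ex; exists g't.
exact/cvg_lim.
Unshelve. all: by end_near. Qed.

(** For the first variable this is the fundamental theorem of calculus applied to the slice
    integral, which vanishes at both ends. Any other variable is treated inside each slice by
    induction. *)
Lemma Ir_derive0 n L (f f' : 'rV[R]_n -> R) i : 0 <= L ->
  nice L f -> nice L f' -> (forall x, is_derive x (ebasis R i) f (f' x)) ->
  Ir f' = 0.
Proof.
move=> L0; elim: n f f' i => [|n IH] f f' i; first by case: i.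
move=> nf nf' df /=; case: (unliftP ord0 i) => [j ij|i0]; last first.
  rewrite i0 in df.
  set g' := fun t => Ir _; pose g t := Ir (fun v => f (vcons t v)).
  have dg (t : R) : is_derive t (1 : R) g (g' t).
    exact: (is_derive_Ir t L0 nf nf' df).
  (* The support condition is strict, so the slice integral may be nonzero at [L] itself; the
     endpoints are moved out by [1]. *)
  rewrite (@Rintegral_supp (L + 1)); last first.
    move=> t Lt; apply: (Ir_slice_supp L0 nf').
    by apply: lt_trans Lt; rewrite ltrDl.
  rewrite /Rintegral (@continuous_FTC2 _ _ g).
  - have L1 : L < `|L + 1| by rewrite ger0_norm ?addr_ge0// ltrDl.
    by rewrite /g !(Ir_slice_supp L0 nf) ?normrN /= ?subrr.
  - by rewrite (@lt_le_trans _ _ 0) ?oppr_lt0 ?addr_ge0// ltr_wpDl.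
  - apply: continuous_subspaceT; exact: Ir_slice_continuous nf'.
  - split=> [t _||]; first exact: ex_derive.
      by apply: cvg_at_right_filter; exact: (Ir_slice_continuous L0 nf).
    by apply: cvg_at_left_filter; exact: (Ir_slice_continuous L0 nf).
  - by move=> t _; rewrite derive1E derive_val.
rewrite (_ : (fun t => _) = cst 0); first by rewrite Rintegral_cst// mul0r.
apply/funext => t.
apply: (IH (fun v => f (vcons t v)) _ j); [exact: nice_slice..|].
by move=> v; apply: is_derive_vcons; rewrite -ij.
Qed.

(** Heine-Cantor on the closed ball of radius [L + 1]. The margin [1] ensures that a point outside
    this ball and any point at distance less than [1] from it both lie off the support. *)
Lemma compact_supp_nice n L (f : 'rV[R]_n -> R) : continuous f ->
  (forall x, L < `|x| -> f x = 0) -> nice L f.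
Proof.
move=> cf sf.
pose K := [set x : 'rV[R]_n | `|x| <= L + 1].
have cK : compact K.
  have -> : K = closed_ball_ (fun x => `|x|) 0 (L + 1).
    by apply/seteqP; split => x; rewrite /K /closed_ball_ /= sub0r normrN.
  apply: bounded_closed_compact; last exact: closed_closed_ball_.
  exists (L + 1); split; first exact: num_real.
  move=> y Ly x; rewrite /closed_ball_ /= sub0r normrN => xL.
  by apply: (le_trans xL); exact: ltW.
split=> //.
- move=> e e0.
  have e20 : 0 < e / 2 by rewrite divr_gt0.
  have /compact_near_coveringP cov := cK.
  have : \forall d \near 0^'+, K `<=`
     [set x | forall y, `|x - y| < d -> `|f x - f y| <= e].
    apply: (cov R (0^'+) (fun d x => forall y, `|x - y| < d -> `|f x - f y| <= e)).
    move=> x Kx.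
    have /cvgrPdist_le/(_ _ e20) := cf x.
    move=> /nbhs_ballP[r /= r0 xr].
    have r20 : 0 < r / 2 by rewrite divr_gt0.
    exists (ball x (r / 2), [set d | d < r / 2]).
      split; first exact: nbhsx_ballx.
      exact: nbhs_right_lt.
    move=> -[x' d] [/= xx' dr] y x'y.
    rewrite -ball_normE/= in xx'.
    have -> : f x' - f y = (f x - f y) - (f x - f x') by ring.
    apply: (le_trans (ler_normB _ _)); rewrite (splitr e); apply: lerD.
      apply: xr; rewrite -ball_normE/=.
      have -> : x - y = (x - x') + (x' - y) by rewrite addrA subrK.
      apply: (le_lt_trans (ler_normD _ _)); rewrite (splitr r).
      by apply: ltrD => //; exact: lt_trans dr.
    apply: xr; rewrite -ball_normE/=; apply: (lt_le_trans xx'); lra.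
  move=> H; near (0 : R)^'+ => d.
  exists (Num.min d 1); first by rewrite lt_min ltr01 andbT.
  move=> x y; rewrite lt_min => /andP[xyd xy1].
  have [xK|xK] := leP `|x| (L + 1).
    move: xyd; have : K `<=` [set x | forall y, `|x - y| < d -> `|f x - f y| <= e].
      by near: d.
    by move=> /(_ x xK) /=; apply.
  have yL : L < `|y|.
    by have := ler_normD (x - y) y; rewrite subrK; lra.
  by rewrite sf ?sf ?subrr ?normr0 ?ltW//; lra.
have cfK : {within K, continuous f} by exact: continuous_subspaceT.
have [M [_ MP]] := compact_bounded (continuous_compact cfK cK).
exists (Num.max 0 (M + 1)) => x.
have [xK|xK] := leP `|x| (L + 1).
  rewrite le_max; apply/orP; right; apply: (MP (M + 1)); first by rewrite ltrDl.
  by exists x.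
by rewrite sf ?normr0 ?le_max ?lexx//; lra.
Unshelve. all: by end_near. Qed.

End compactly_supported_integral.

(** * Partial derivatives and the fields [x . grad] and [x_i d_j - x_j d_i] *)

Section pointwise_rules.
Context {R : realType} {V : normedModType R}.
Implicit Types (f g : V -> R) (x v : V).

(** These rules are restated for explicit abstractions, the form in which sums and products of
    functions occur below. *)
Lemma is_derive_fD f g x v a b : is_derive x v f a -> is_derive x v g b ->
  is_derive x v (fun x => f x + g x) (a + b).
Proof. by move=> df dg; exact: is_deriveD. Qed.

Lemma is_derive_fB f g x v a b : is_derive x v f a -> is_derive x v g b ->
  is_derive x v (fun x => f x - g x) (a - b).
Proof. by move=> df dg; exact: is_deriveB. Qed.

Lemma is_derive_fM f g x v a b : is_derive x v f a -> is_derive x v g b ->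
  is_derive x v (fun x => f x * g x) (f x * b + g x * a).
Proof. by move=> df dg; exact: is_deriveM. Qed.

Lemma is_derive_fsum (I : Type) (r : seq I) (F : I -> V -> R) (d : I -> R) x v :
  (forall i, is_derive x v (F i) (d i)) ->
  is_derive x v (fun x => \sum_(i <- r) F i x) (\sum_(i <- r) d i).
Proof.
move=> dF; elim: r => [|i r IH].
  rewrite big_nil; under eq_fun do rewrite big_nil; exact: is_derive_cst.
rewrite big_cons; under eq_fun do rewrite big_cons.
exact: is_derive_fD.
Qed.

End pointwise_rules.

Section partial_derivatives.
Context {R : realType} {N : nat}.
Implicit Types (f g : 'rV[R]_N -> R) (x v w : 'rV[R]_N).

Lemma is_derive_coord x i j :
  is_derive x (ebasis R i) (fun x => x ord0 j) ((i == j)%:R).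
Proof.
have lim : h^-1 *: (((fun x : 'rV[R]_N => x ord0 j) \o shift x) (h *: ebasis R i)
    - x ord0 j) @[h --> 0^'] --> ((i == j)%:R : R).
  apply: cvg_near_cst; near=> h.
  have h0 : h != 0 by near: h; exact: nbhs_dnbhs_neq.
  rewrite /= lincomb_coordE ebasisE addrK /GRing.scale/= mulrA mulVf// mul1r.
  by rewrite eq_sym.
by split; [apply/cvg_ex; eexists; exact: lim|exact: cvg_lim].
Unshelve. all: by end_near. Qed.

(** Two mean value theorems: along [v] for the increment of [f] in the direction [h w], then along
    [w] for ['D_v f]. *)
Lemma mixed_difference f v w x h : 0 < h ->
  (forall y, derivable f y v) -> (forall y, derivable ('D_v f) y w) ->
  exists s t, [/\ 0 < s < h, 0 < t < h &
    f (h *: v + (h *: w + x)) - f (h *: v + x) - f (h *: w + x) + f x =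
    h * (h * 'D_w ('D_v f) (t *: w + (s *: v + x)))].
Proof.
move=> h0 df ddf.
pose phi (s : R) := f (s *: v + (h *: w + x)) - f (s *: v + x).
pose dphi (s : R) := 'D_v f (s *: v + (h *: w + x)) - 'D_v f (s *: v + x).
have phi' s : is_derive s (1 : R) phi (dphi s).
  exact: (is_derive_fB (is_derive_line (derivableP (df _)))
                       (is_derive_line (derivableP (df _)))).
have cphi : {within `[0, h], continuous phi}.
  by apply: derivable_within_continuous => s _; exact: ex_derive.
have [s] := MVT h0 (fun s _ => phi' s) cphi; rewrite in_itv/= => sh Es.
pose psi (t : R) := 'D_v f (t *: w + (s *: v + x)).
have psi' t : is_derive t (1 : R) psi ('D_w ('D_v f) (t *: w + (s *: v + x))).
  exact: (is_derive_line (derivableP (ddf _))).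
have cpsi : {within `[0, h], continuous psi}.
  by apply: derivable_within_continuous => t _; exact: ex_derive.
have [t] := MVT h0 (fun t _ => psi' t) cpsi; rewrite in_itv/= => th Et.
exists s, t; split => //.
transitivity (phi h - phi 0); first by rewrite /phi !scale0r !add0r; ring.
have -> : h * (h * 'D_w ('D_v f) (t *: w + (s *: v + x))) = h * (psi h - psi 0).
  by rewrite Et subr0; ring.
by rewrite Es subr0 /psi scale0r add0r /dphi mulrC [s *: v + (h *: w + x)]addrCA.
Qed.

(** The second difference is symmetric in [v] and [w], so [mixed_difference] in both orders equates
    the two mixed derivatives at two points close to [x]; continuity at [x] concludes. *)
Lemma schwarz f v w x :
  (forall y, derivable f y v) -> (forall y, derivable f y w) ->
  (forall y, derivable ('D_v f) y w) -> (forall y, derivable ('D_w f) y v) ->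
  {for x, continuous ('D_w ('D_v f))} -> {for x, continuous ('D_v ('D_w f))} ->
  'D_w ('D_v f) x = 'D_v ('D_w f) x.
Proof.
move=> dv dw dvw dwv cvw cwv; apply/eqP; rewrite -subr_eq0 -normr_le0.
apply/ler_addgt0Pl => e e0; rewrite addr0.
have e20 : 0 < e / 2 by rewrite divr_gt0.
move: cvw => /cvgrPdist_le/(_ _ e20)/nbhs_ballP[r /= r0 xr].
move: cwv => /cvgrPdist_le/(_ _ e20)/nbhs_ballP[r' /= r'0 xr'].
(* With [h K = min r r'], a displacement by less than [h] along both directions stays within the two
   radii; the extra [1] makes this strict and [K] positive. *)
pose K := `|v| + `|w| + 1.
have K0 : 0 < K by rewrite ltr_wpDl// addr_ge0.
pose h := Num.min r r' / K.
have h0 : 0 < h by rewrite divr_gt0// lt_min r0.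
have near_x (a b : R) (v' w' : 'rV[R]_N) : 0 < a < h -> 0 < b < h ->
    `|v'| + `|w'| + 1 = K -> `|x - (b *: w' + (a *: v' + x))| < Num.min r r'.
  move=> /andP[a0 ah] /andP[b0 bh] vwK.
  have -> : x - (b *: w' + (a *: v' + x)) = - (b *: w' + a *: v').
    by rewrite [a *: _ + _]addrC addrCA opprD addNKr.
  rewrite normrN; apply: (le_lt_trans (ler_normD _ _)).
  rewrite !normrZ !gtr0_norm//.
  have : h * K = Num.min r r' by rewrite /h divfK// gt_eqF.
  move=> <-; rewrite -vwK mulrDr mulr1 mulrDr addrC.
  by apply: ltr_pwDr => //; apply: lerD; apply: ler_wpM2r => //; exact: ltW.
have [s [t [sh th Est]]] := mixed_difference x h0 dv dvw.
have [s' [t' [sh' th' Est']]] := mixed_difference x h0 dw dwv.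
have E : 'D_w ('D_v f) (t *: w + (s *: v + x)) =
         'D_v ('D_w f) (t' *: v + (s' *: w + x)).
  apply: (mulfI (lt0r_neq0 h0)); apply: (mulfI (lt0r_neq0 h0)).
  have C : h *: w + (h *: v + x) = h *: v + (h *: w + x) by exact: addrCA.
  apply: etrans (esym Est) (etrans _ Est').
  by rewrite C [f _ - f _ - f _]addrAC.
have := near_x _ _ v w sh th erefl; rewrite lt_min => /andP[xb _].
have := near_x _ _ w v sh' th' _; rewrite lt_min => /(_ _)/andP[|_ xb'].
  by rewrite /K [`|w| + _]addrC.
rewrite -ball_normE in xr; rewrite -ball_normE in xr'.
have A := xr _ xb; have B := xr' _ xb'; rewrite /= in A B.
have close (a b c d : R) : c = d -> `|a - c| <= e / 2 -> `|b - d| <= e / 2 ->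
    `|a - b| <= e.
  move=> -> ad bd; have -> : a - b = (a - d) - (b - d) by ring.
  by apply: (le_trans (ler_normB _ _)); rewrite (splitr e); exact: lerD.
exact: close E A B.
Qed.

Local Notation d_ i f := ('D_(ebasis R i) f).

(** Differentiability is counted along coordinate directions because [euler] and [rot] each cost
    exactly one order. *)
Fixpoint Ck (k : nat) (f : 'rV[R]_N -> R) : Prop :=
  continuous f /\
  match k with
  | 0 => True
  | k'.+1 => forall i, (forall x, derivable f x (ebasis R i)) /\ Ck k' (d_ i f)
  end.

Lemma Ck_continuous k f : Ck k f -> continuous f.
Proof. by case: k => [|k] []. Qed.

Arguments Ck_continuous {k f} _ x.

Lemma Ck_derivable k f i x : Ck k.+1 f -> derivable f x (ebasis R i).
Proof. by case=> _ /(_ i)[]. Qed.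

Arguments Ck_derivable {k f} i x _.

Lemma Ck_is_derive k f i x : Ck k.+1 f -> is_derive x (ebasis R i) f (d_ i f x).
Proof. by move=> fk; exact: (derivableP (Ck_derivable i x fk)). Qed.

Arguments Ck_is_derive {k f} i x _.

Lemma Ck_partial k f i : Ck k.+1 f -> Ck k (d_ i f).
Proof. by case=> _ /(_ i)[]. Qed.

Arguments Ck_partial {k f} i _.

Lemma Ck_le k m f : (m <= k)%N -> Ck k f -> Ck m f.
Proof.
elim: k m f => [|k IH] [|m] f //=; first by move=> _ [].
by move=> mk [cf df]; split=> // i; have [? ?] := df i; split=> //; exact: IH.
Qed.

Lemma Ck_cst k c : Ck k (fun=> c).
Proof.
elim: k c => [|k IH] c; split=> //; try exact: cst_continuous.
move=> i; split=> [x|]; first exact: derivable_cst.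
rewrite (_ : 'D_ _ _ = fun=> 0); first exact: IH.
by apply/funext => x; rewrite derive_cst.
Qed.

Lemma CkD k f g : Ck k f -> Ck k g -> Ck k (fun x => f x + g x).
Proof.
elim: k f g => [|k IH] f g fk gk; split=> //.
- by move=> x; exact: (cvgD (Ck_continuous fk x) (Ck_continuous gk x)).
- by move=> x; exact: (cvgD (Ck_continuous fk x) (Ck_continuous gk x)).
move=> i; have D x := is_derive_fD (Ck_is_derive i x fk) (Ck_is_derive i x gk).
split=> [x|]; first exact: ex_derive.
rewrite (_ : 'D_ _ _ = fun x => d_ i f x + d_ i g x).
  by apply: IH; exact: Ck_partial.
by apply/funext => x; rewrite derive_val.
Qed.

Lemma CkM k f g : Ck k f -> Ck k g -> Ck k (fun x => f x * g x).
Proof.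
elim: k f g => [|k IH] f g fk gk; split=> //.
- by move=> x; exact: (cvgM (Ck_continuous fk x) (Ck_continuous gk x)).
- by move=> x; exact: (cvgM (Ck_continuous fk x) (Ck_continuous gk x)).
move=> i; have D x := is_derive_fM (Ck_is_derive i x fk) (Ck_is_derive i x gk).
split=> [x|]; first exact: ex_derive.
rewrite (_ : 'D_ _ _ = fun x => f x * d_ i g x + g x * d_ i f x).
  by apply: CkD; apply: IH; try exact: Ck_partial; exact: (@Ck_le k.+1).
by apply/funext => x; rewrite derive_val.
Qed.

Lemma CkB k f g : Ck k f -> Ck k g -> Ck k (fun x => f x - g x).
Proof.
move=> fk gk; have := CkD fk (CkM (Ck_cst k (-1)) gk).
by congr (Ck k); apply/funext => x; rewrite mulN1r.
Qed.

Lemma Ck_coord k j : Ck k (fun x => x ord0 j).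
Proof.
case: k => [|k]; split=> //; try exact: coord_continuous.
move=> i; have D x := is_derive_coord x i j.
split=> [x|]; first exact: ex_derive.
rewrite (_ : 'D_ _ _ = fun=> (i == j)%:R : R); first exact: Ck_cst.
by apply/funext => x; rewrite derive_val.
Qed.

Lemma Ck_sum k (I : Type) (r : seq I) (F : I -> 'rV[R]_N -> R) :
  (forall i, Ck k (F i)) -> Ck k (fun x => \sum_(i <- r) F i x).
Proof.
move=> FC; elim: r => [|i r IH].
  by under eq_fun do rewrite big_nil; exact: Ck_cst.
by under eq_fun do rewrite big_cons; exact: CkD.
Qed.

Lemma smooth_Ck k f : smooth f -> Ck k f.
Proof.
suff H (s : seq 'rV[R]_N) : smooth f -> Ck k (Dlist s f) by exact: (H [::]).
elim: k s => [|k IH] s sf; split=> //; try by have [] := sf s.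
move=> i; split=> [x|]; first by have [_] := sf s; apply.
exact: (IH (ebasis R i :: s)).
Qed.

Definition euler f x : R := \sum_(i < N) x ord0 i * d_ i f x.

Definition rot i j f x : R := x ord0 i * d_ j f x - x ord0 j * d_ i f x.

Lemma Ck_euler k f : Ck k.+1 f -> Ck k (euler f).
Proof.
move=> fk; apply: Ck_sum => i; apply: CkM; first exact: Ck_coord.
exact: Ck_partial.
Qed.

Lemma Ck_rot k i j f : Ck k.+1 f -> Ck k (rot i j f).
Proof.
by move=> fk; apply: CkB; apply: CkM; try exact: Ck_coord; exact: Ck_partial.
Qed.

Lemma eulerM f g x : Ck 1 f -> Ck 1 g ->
  euler (fun x => f x * g x) x = f x * euler g x + g x * euler f x.
Proof.
move=> f1 g1; rewrite /euler !mulr_sumr -big_split; apply: eq_bigr => i _ /=.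
have D := is_derive_fM (Ck_is_derive i x f1) (Ck_is_derive i x g1).
by rewrite derive_val; ring.
Qed.

Lemma rotM i j f g x : Ck 1 f -> Ck 1 g ->
  rot i j (fun x => f x * g x) x = f x * rot i j g x + g x * rot i j f x.
Proof.
move=> f1 g1; rewrite /rot.
have D := is_derive_fM (Ck_is_derive i x f1) (Ck_is_derive i x g1).
have D' := is_derive_fM (Ck_is_derive j x f1) (Ck_is_derive j x g1).
rewrite (@derive_val _ _ _ _ _ _ _ D) (@derive_val _ _ _ _ _ _ _ D').
move: (d_ i f x) (d_ j f x) (d_ i g x) (d_ j g x) => a b c d; ring.
Qed.

Lemma partial_comm f i j x : Ck 2 f -> d_ i (d_ j f) x = d_ j (d_ i f) x.
Proof.
move=> f2; have f1 k := Ck_partial k f2.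
have c k l := Ck_continuous (Ck_partial k (f1 l)).
exact: (schwarz (fun y => Ck_derivable j y f2) (fun y => Ck_derivable i y f2)
  (fun y => Ck_derivable i y (f1 j)) (fun y => Ck_derivable j y (f1 i))
  (c i j x) (c j i x)).
Qed.

Lemma partial_euler f i x : Ck 2 f ->
  d_ i (euler f) x = d_ i f x + \sum_(k < N) x ord0 k * d_ i (d_ k f) x.
Proof.
move=> f2.
have D k := is_derive_fM (is_derive_coord x i k)
  (Ck_is_derive i x (Ck_partial k f2)).
have E := is_derive_fsum (index_enum 'I_N) D.
apply: (etrans (@derive_val _ _ _ _ _ _ _ E)).
rewrite big_split /= addrC; congr (_ + _).
rewrite (bigD1 i)//= eqxx mulr1 big1 ?addr0// => k ki.
by rewrite eq_sym (negPf ki) mulr0.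
Qed.

Lemma partial_rot f k i j x : Ck 2 f ->
  d_ k (rot i j f) x = (k == i)%:R * d_ j f x - (k == j)%:R * d_ i f x
    + (x ord0 i * d_ k (d_ j f) x - x ord0 j * d_ k (d_ i f) x).
Proof.
move=> f2.
have D i j := is_derive_fM (is_derive_coord x k i)
  (Ck_is_derive k x (Ck_partial j f2)).
have E := is_derive_fB (D i j) (D j i).
apply: (etrans (@derive_val _ _ _ _ _ _ _ E)).
move: (d_ k (d_ j f) x) (d_ k (d_ i f) x) (d_ i f x) (d_ j f x) => a b c d; ring.
Qed.

(** * Algebra of the gradient and the Hessian at a point *)

Section second_order_algebra.
Variables (X G : 'I_N -> R) (H : 'I_N -> 'I_N -> R).

Let pick_sum (F : 'I_N -> R) l : \sum_(k < N) X k * ((k == l)%:R * F k) = X l * F l.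
Proof.
rewrite (bigD1 l)//= eqxx mul1r big1 ?addr0// => k kl.
by rewrite (negPf kl) mul0r mulr0.
Qed.

(** With [X] the point, [G] the gradient and [H] the Hessian, both sides are expanded second
    derivatives of [f]; symmetry of [H] matches them. *)
Lemma euler_rot_sum i j : (forall k l, H k l = H l k) ->
  \sum_(k < N) X k * ((k == i)%:R * G j - (k == j)%:R * G i
      + (X i * H k j - X j * H k i)) =
  X i * (G j + \sum_(k < N) X k * H j k) - X j * (G i + \sum_(k < N) X k * H i k).
Proof.
move=> HC; under eq_bigr do rewrite mulrDr mulrBr.
rewrite big_split sumrB /= (pick_sum (fun=> G j)) (pick_sum (fun=> G i)).
rewrite !mulrDr !mulr_sumr opprD addrACA -sumrB; congr (_ + _).
by apply: eq_bigr => k _; rewrite (HC k j) (HC k i); ring.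
Qed.

(** The sum runs over ordered pairs, so every rotation plane is counted twice; this is the source of
    the factor [2^-1] in [laplacian_polar]. *)
Lemma rot_rot_sum :
  \sum_(i < N) \sum_(j < N)
    (X i * ((j == i)%:R * G j - (j == j)%:R * G i + (X i * H j j - X j * H j i))
     - X j * ((i == i)%:R * G j - (i == j)%:R * G i + (X i * H i j - X j * H i i))) =
  2 * ((\sum_(i < N) X i ^+ 2) * \sum_(i < N) H i i)
  - 2 * (\sum_(i < N) \sum_(j < N) X i * X j * H i j)
  - 2 * (N%:R * \sum_(i < N) X i * G i) + 2 * \sum_(i < N) X i * G i.
Proof.
have sw (F : 'I_N -> 'I_N -> R) : \sum_(i < N) \sum_(j < N) (F i j + F j i) =
    2 * \sum_(i < N) \sum_(j < N) F i j.
  under eq_bigr do rewrite big_split /=.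
  by rewrite big_split /= [X in _ + X]exchange_big /=; ring.
(* Each summand is put in the symmetric form that [sw] evaluates. The last term corrects the
   diagonal [i = j], where the rotation vanishes. *)
transitivity (\sum_(i < N) \sum_(j < N)
  ((X i ^+ 2 * H j j + X j ^+ 2 * H i i) - (X i * X j * H i j + X j * X i * H j i)
   - (X i * G i + X j * G j) + 2 * (X j * ((j == i)%:R * G j)))).
  apply: eq_bigr => i _; apply: eq_bigr => j _.
  by rewrite !eqxx [i == j]eq_sym; case: eqP => [->|_] /=; ring.
under eq_bigr do rewrite big_split /= !sumrB -mulr_sumr pick_sum.
rewrite big_split /= !sumrB -mulr_sumr.
rewrite (sw (fun i j => X i ^+ 2 * H j j)) (sw (fun i j => X i * X j * H i j)).
rewrite (sw (fun i j => X i * G i)) big_distrlr; congr (_ - _ - 2 * _ + _).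
by rewrite exchange_big /= sumr_const card_ord mulr_natl.
Qed.

End second_order_algebra.

Lemma euler_rot f i j x : Ck 2 f -> euler (rot i j f) x = rot i j (euler f) x.
Proof.
move=> f2.
have E := @euler_rot_sum (fun k => x ord0 k) (fun k => d_ k f x)
  (fun k l => d_ k (d_ l f) x) i j (fun k l => partial_comm k l x f2).
apply: etrans (etrans E _).
  by apply: eq_bigr => k _; congr (_ * _); exact: partial_rot.
by congr (_ * _ - _ * _); apply/esym; exact: partial_euler.
Qed.

(** Both sides reduce to the Laplacian, the first-order term [euler f] and the quadratic form [T] of
    the Hessian at [x], since [E E f = E f + T]. Multiplying by [|x|^2] keeps the identity valid at
    the origin. *)
Lemma laplacian_polar f x : Ck 2 f ->
  (\sum_(i < N) x ord0 i ^+ 2) * laplacian f x =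
  euler (euler f) x + (N%:R - 2) * euler f x
    + 2^-1 * \sum_(i < N) \sum_(j < N) rot i j (rot i j f) x.
Proof.
move=> f2.
pose X (k : 'I_N) := x ord0 k; pose G k := d_ k f x; pose H k l := d_ k (d_ l f) x.
have rr i j : rot i j (rot i j f) x =
    X i * ((j == i)%:R * G j - (j == j)%:R * G i + (X i * H j j - X j * H j i))
     - X j * ((i == i)%:R * G j - (i == j)%:R * G i + (X i * H i j - X j * H i i)).
  by congr (_ * _ - _ * _); exact: partial_rot.
rewrite (eq_bigr _ (fun i _ => eq_bigr _ (fun j _ => rr i j))) rot_rot_sum.
pose T := \sum_(i < N) \sum_(j < N) x ord0 i * x ord0 j * d_ i (d_ j f) x.
have -> : euler (euler f) x = euler f x + T.
  rewrite /euler /T -big_split; apply: eq_bigr => i _.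
  apply: etrans (congr1 _ (partial_euler i x f2)) _.
  rewrite mulrDr mulr_sumr; congr (_ + _).
  by apply: eq_bigr => j _; rewrite mulrA.
rewrite -[\sum_(i < N) H i i]/(laplacian f x) -[\sum_(i < N) X i * G i]/(euler f x).
rewrite -[\sum_(i < N) \sum_(j < N) X i * X j * H i j]/T.
by move: (laplacian f x) (euler f x) T => a b c; field.
Qed.

End partial_derivatives.

(** * Integration by parts with radial weights *)

Section radial_weights.
Context {R : realType} {N : nat}.
Implicit Types (f g : 'rV[R]_N -> R) (x v w : 'rV[R]_N) (h dh : R -> R).
Local Notation d_ i f := ('D_(ebasis R i) f).

(** Radial weights are written as functions of [|x|^2], a polynomial, so that composing with them
    raises no regularity question at the origin. *)
Definition sqn x : R := \sum_(i < N) x ord0 i ^+ 2.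

Lemma sqn_ge0 x : 0 <= sqn x.
Proof. by apply: sumr_ge0 => i _; exact: sqr_ge0. Qed.

Lemma normr_sqn x : `|x| ^+ 2 <= sqn x.
Proof.
suff : `|x| <= Num.sqrt (sqn x).
  move=> H; rewrite -[leRHS]sqr_sqrtr ?sqn_ge0//.
  by rewrite lerXn2r ?nnegrE ?sqrtr_ge0.
apply: ler_norm_coord => [|j]; first exact: sqrtr_ge0.
rewrite -sqrtr_sqr ler_wsqrtr// /sqn (bigD1 j)//= lerDl.
by apply: sumr_ge0 => i _; exact: sqr_ge0.
Qed.

Lemma Ck_sqn k : Ck k sqn.
Proof.
by apply: Ck_sum => i; under eq_fun do rewrite expr2; apply: CkM; exact: Ck_coord.
Qed.

Lemma continuous_sqn : continuous sqn.
Proof. exact: (Ck_continuous (Ck_sqn 0)). Qed.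

Lemma is_derive_sqn x i : is_derive x (ebasis R i) sqn (2 * x ord0 i).
Proof.
have D j := is_derive_fM (is_derive_coord x i j) (is_derive_coord x i j).
have E := is_derive_fsum (index_enum 'I_N) D.
have -> : sqn = (fun x => \sum_(j <- index_enum 'I_N) x ord0 j * x ord0 j).
  by apply/funext => y; apply: eq_bigr => j _; rewrite expr2.
apply: (is_derive_eq E).
rewrite (bigD1 i)//= eqxx big1 ?addr0 => [|j ji] /=; first by ring.
by rewrite eq_sym (negPf ji) mulr0 addr0.
Qed.

Lemma is_derive_of_line f (a v : 'rV[R]_N) d :
  is_derive (0 : R) (1 : R) (fun h : R => f (h *: v + a)) d -> is_derive a v f d.
Proof.
suff E : (fun h : R => h^-1 *: ((f \o shift a) (h *: v) - f a))
  = (fun h : R => h^-1 *: (((fun h : R => f (h *: v + a)) \o shift 0) (h *: 1)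
       - (fun h : R => f (h *: v + a)) 0)).
  by case=> df <-; split; rewrite /derivable /derive E.
apply/funext => h /=; congr (_ *: (f _ - f _)).
  by rewrite addr0 [_%:A]mulr1.
by rewrite scale0r add0r.
Qed.

Lemma is_derive_radial h d x i : is_derive (sqn x) (1 : R) h d ->
  is_derive x (ebasis R i) (fun x => h (sqn x)) (d * (2 * x ord0 i)).
Proof.
move=> dh; apply: is_derive_of_line.
have x0 : 0 *: ebasis R i + x = x by rewrite scale0r add0r.
have D : is_derive (0 : R) (1 : R) (fun t => sqn (t *: ebasis R i + x)) (2 * x ord0 i).
  by apply: is_derive_line; rewrite x0; exact: is_derive_sqn.
apply: (is_derive1_comp (g := fun t => sqn (t *: ebasis R i + x))).
by rewrite x0.
Qed.

(** The exterior region [b < sqn x] is open, so partial derivatives inherit the vanishing condition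
    with the same [b]. *)
Definition Cc k (b : R) f := Ck k f /\ forall x, b < sqn x -> f x = 0.

Lemma near_sqn_gt (b : R) x : b < sqn x -> \forall y \near x, b < sqn y.
Proof. by move=> bx; apply: (cvgr_gt _ (continuous_sqn (x := x))). Qed.

Lemma partial_supp b f i : (forall x, b < sqn x -> f x = 0) ->
  forall x, b < sqn x -> d_ i f x = 0.
Proof.
move=> sf x bx; apply: (etrans (@near_eq_derive _ _ _ f (fun=> 0) x _ _)).
  by apply: filterS (near_sqn_gt bx) => y; exact: sf.
exact: derive_cst.
Qed.

Lemma Cc_le k m b f : (m <= k)%N -> Cc k b f -> Cc m b f.
Proof. by move=> mk [fk sf]; split=> //; exact: Ck_le fk. Qed.

Lemma CcD k b f g : Cc k b f -> Cc k b g -> Cc k b (fun x => f x + g x).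
Proof.
move=> [fk sf] [gk sg]; split; first exact: CkD.
by move=> x bx; rewrite sf// sg// addr0.
Qed.

Lemma CcM k b f g : Ck k f -> Cc k b g -> Cc k b (fun x => f x * g x).
Proof.
move=> fk [gk sg]; split; first exact: CkM.
by move=> x bx; rewrite sg// mulr0.
Qed.

Lemma Cc_partial k b f i : Cc k.+1 b f -> Cc k b (d_ i f).
Proof.
by move=> [fk sf]; split; [exact: Ck_partial|exact: partial_supp].
Qed.

Lemma Cc_euler k b f : Cc k.+1 b f -> Cc k b (euler f).
Proof.
move=> [fk sf]; split; first exact: Ck_euler.
move=> x bx; rewrite /euler big1// => i _.
by rewrite (partial_supp i sf)// mulr0.
Qed.

Lemma Cc_rot k b f i j : Cc k.+1 b f -> Cc k b (rot i j f).
Proof.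
move=> [fk sf]; split; first exact: Ck_rot.
by move=> x bx; rewrite /rot !(partial_supp _ sf)// !mulr0 subrr.
Qed.

Lemma Cc_laplacian k b f : Cc k.+2 b f -> Cc k b (laplacian f).
Proof.
move=> f2; split; first by apply: Ck_sum => i; do 2 apply: Ck_partial; case: f2.
move=> x bx; rewrite /laplacian big1// => i _.
by case: (Cc_partial i (Cc_partial i f2)) => _; apply.
Qed.

Lemma Cc_nice k b f L : b <= L ^+ 2 -> 0 <= L -> Cc k b f -> nice L f.
Proof.
move=> bL L0 [fk sf]; apply: compact_supp_nice; first exact: Ck_continuous fk.
move=> x Lx; apply: sf; apply: le_lt_trans bL _; apply: lt_le_trans (normr_sqn x).
by rewrite ltrXn2r// ?nnegrE.
Qed.

(** Regularity is asked only below [1], where the weights may blow up. Including [s <= 0] gives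
    two-sided derivatives at the value [0] taken at the origin. *)
Definition radial_C1 h dh := forall s : R, s < 1 ->
  is_derive s (1 : R) h (dh s) /\ {for s, continuous dh}.

Section weighted.
Variables (h dh : R -> R) (b : R) (f : 'rV[R]_N -> R).
Hypotheses (hC : radial_C1 h dh) (b1 : b < 1) (f1 : Cc 1 b f).

(** Where [sqn x < 1] both factors are continuous; elsewhere [b < sqn x], so the product is zero
    near [x] whatever the weight does. The same split gives [is_derive_weighted]. *)
Lemma continuous_weighted h' g : (forall s : R, s < 1 -> {for s, continuous h'}) ->
  Cc 0 b g -> Cc 0 b (fun x => h' (sqn x) * g x).
Proof.
move=> ch' [[cg _] sg]; split; last by move=> x bx; rewrite sg// mulr0.
split=> // x; have [x1|x1] := ltP (sqn x) 1.
  have cW : {for x, continuous (fun x => h' (sqn x))}.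
    exact: (@continuous_comp _ _ _ sqn h' x (@continuous_sqn x) (ch' _ x1)).
  exact: (cvgM cW (cg x)).
have bx : b < sqn x by exact: lt_le_trans x1.
have F : Filter (nbhs x) by exact: nbhs_filter.
rewrite /continuous_at sg// mulr0; apply: (@cvg_near_cst _ _ _ _ (nbhs x)).
near=> y.
by rewrite sg ?mulr0//; near: y; exact: near_sqn_gt.
Unshelve. all: by end_near. Qed.

Lemma is_derive_weighted x i :
  is_derive x (ebasis R i) (fun x => h (sqn x) * f x)
    (h (sqn x) * d_ i f x + dh (sqn x) * (2 * x ord0 i * f x)).
Proof.
have [f1C sf] := f1.
have [x1|x1] := ltP (sqn x) 1.
  have [dhx _] := hC x1.
  apply: is_derive_eq (is_derive_fM (is_derive_radial i dhx) (Ck_is_derive i x f1C)) _.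
  by move: (d_ i f x) => a; ring.
have bx : b < sqn x by exact: lt_le_trans x1.
rewrite (partial_supp i sf)// sf// !mulr0 addr0.
apply: (near_eq_is_derive (f := fun=> 0) _ (is_derive_cst 0 x (ebasis R i))).
by apply: filterS (near_sqn_gt bx) => y by_; rewrite sf// mulr0.
Qed.

Lemma Cc_weighted : Cc 1 b (fun x => h (sqn x) * f x).
Proof.
have [f1C sf] := f1.
have ch (s : R) : s < 1 -> {for s, continuous h}.
  move=> s1; apply/differentiable_continuous/derivable1_diffP.
  by have [] := hC s1.
have W0 := continuous_weighted ch (Cc_le (leq0n _) f1).
split; last by case: W0.
split; first exact: (Ck_continuous W0.1).
move=> i; have D x := is_derive_weighted x i.
split=> [x|]; first by have [] := D x.
rewrite (_ : 'D_ _ _ = fun x => h (sqn x) * d_ i f x +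
   dh (sqn x) * (2 * x ord0 i * f x)).
  suff : Cc 0 b (fun x => h (sqn x) * d_ i f x + dh (sqn x) * (2 * x ord0 i * f x)).
    by case.
  apply: CcD; apply: continuous_weighted => //.
  - exact: Cc_partial.
  - by move=> s /hC[].
  - apply: CcM; first by apply: CkM; [exact: Ck_cst|exact: Ck_coord].
    exact: (Cc_le (leq0n _) f1).
by apply/funext => x; have [_ ->] := D x.
Qed.

Lemma is_derive_coord_weighted j i x :
  is_derive x (ebasis R i) (fun x => x ord0 j * (h (sqn x) * f x))
    (x ord0 j * (h (sqn x) * d_ i f x + dh (sqn x) * (2 * x ord0 i * f x))
     + h (sqn x) * f x * (i == j)%:R).
Proof. exact: is_derive_fM (is_derive_coord x i j) (is_derive_weighted x i). Qed.

(** The radius [2] is one common choice that covers the unit ball and keeps all integrands in the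
    same class. *)
Lemma Ir_partial_weighted j i :
  nice 2 (d_ i (fun x => x ord0 j * (h (sqn x) * f x))) /\
  Ir (d_ i (fun x => x ord0 j * (h (sqn x) * f x))) = 0.
Proof.
have C1 : Cc 1 b (fun x => x ord0 j * (h (sqn x) * f x)).
  by apply: CcM; [exact: Ck_coord|exact: Cc_weighted].
have b2 : b <= 2 ^+ 2 by rewrite (le_trans (ltW b1))// expr2; lra.
have n1 := Cc_nice b2 (ler0n _ _) (Cc_partial i C1).
split=> //; apply: (@Ir_derive0 _ _ 2 _ _ i _ (Cc_nice b2 (ler0n _ _) C1)) => //.
by move=> x; have [D _] := is_derive_coord_weighted j i x; exact: derivableP.
Qed.

(** Divergence theorem for the field [x h(|x|^2) f]: [F] is its divergence, and [E] acts on
    functions of [s = |x|^2] as [2 s d/ds]. *)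
Lemma Ir_euler_weighted :
  let F := fun x => h (sqn x) * euler f x +
    (N%:R * h (sqn x) + 2 * sqn x * dh (sqn x)) * f x in
  nice 2 F /\ Ir F = 0.
Proof.
move=> F.
suff [nS IS] : nice 2 (fun x =>
    \sum_(i < N) d_ i (fun x => x ord0 i * (h (sqn x) * f x)) x) /\
    Ir (fun x => \sum_(i < N) d_ i (fun x => x ord0 i * (h (sqn x) * f x)) x) = 0.
  have -> : F = fun x => \sum_(i < N) d_ i (fun x => x ord0 i * (h (sqn x) * f x)) x.
    apply/funext => x.
    under eq_bigr => i _ do rewrite (@derive_val _ _ _ _ _ _ _
      (is_derive_coord_weighted i i x)) eqxx mulr1.
    rewrite big_split /= sumr_const card_ord /F -[_ *+ N]mulr_natl.
    have -> : \sum_(i < N) x ord0 i *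
        (h (sqn x) * d_ i f x + dh (sqn x) * (2 * x ord0 i * f x)) =
        h (sqn x) * euler f x + 2 * sqn x * dh (sqn x) * f x.
      rewrite /euler {3}/sqn mulr_sumr mulr_sumr !mulr_suml -big_split /=.
      by apply: eq_bigr => i _; move: (d_ i f x) => a; ring.
    by move: (euler f x) => a; ring.
  by [].
elim: (index_enum _) => [|i r [nr Ir0]].
  by under eq_fun do rewrite big_nil; split; [exact: nice0|exact: Ir0].
under eq_fun do rewrite big_cons -[X in _ + X]mul1r.
have [ni Ii] := Ir_partial_weighted i i.
by split; [exact: niceZD|rewrite (Ir_linear _ (ler0n _ 2))// Ii Ir0 mulr0 addr0].
Qed.

(** [F] is [d_j (x_i h f) - d_i (x_j h f)]: rotations annihilate radial functions, so the
    derivatives of the weight cancel. *)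
Lemma Ir_rot_weighted i j :
  let F := fun x => h (sqn x) * rot i j f x in nice 2 F /\ Ir F = 0.
Proof.
move=> F; have [n1 I1] := Ir_partial_weighted i j.
have [n2 I2] := Ir_partial_weighted j i.
have -> : F = fun x => d_ j (fun x => x ord0 i * (h (sqn x) * f x)) x +
   (-1) * d_ i (fun x => x ord0 j * (h (sqn x) * f x)) x.
  apply/funext => x; rewrite (@derive_val _ _ _ _ _ _ _
    (is_derive_coord_weighted i j x)) (@derive_val _ _ _ _ _ _ _
    (is_derive_coord_weighted j i x)) /F /rot [j == i]eq_sym.
  by move: (d_ i f x) (d_ j f x) => a c; ring.
by split; [exact: niceZD|rewrite (Ir_linear _ (ler0n _ 2))// I1 I2 mulr0 addr0].
Qed.

End weighted.
End radial_weights.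

(** * The cutoff profile and the Riccati solutions *)

Section radial_profiles.
Context {R : realType}.
Implicit Types (s t y : R) (h dh g dg : R -> R).

Definition sqpos y : R := Num.max y 0 ^+ 2.

Lemma is_derive_sqpos y : is_derive y (1 : R) sqpos (2 * Num.max y 0).
Proof.
(* A quadratic Taylor remainder, uniform in [y], which also covers the kink of the positive part at
   [0]. *)
have est k : `|sqpos (k + y) - sqpos y - k * (2 * Num.max y 0)| <= `|k| * `|k|.
  rewrite /sqpos -normrM [leRHS]ger0_norm -?expr2 ?sqr_ge0// ler_norml.
  by case: (leP y 0) => y0; case: (leP (k + y) 0) => ky0; apply/andP; split; nra.
have lim : k^-1 *: ((sqpos \o shift y) (k *: (1 : R)) - sqpos y) @[k --> 0^']
    --> 2 * Num.max y 0.
  apply/cvgrPdist_le => e e0; near=> k.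
  have k0 : k != 0 by near: k; exact: nbhs_dnbhs_neq.
  have ke : `|k| <= e by near: k; exact: dnbhs0_le.
  rewrite -normrN opprB /= [k *: _]mulr1 -(ler_pM2l (x := `|k|)) ?normr_gt0//.
  rewrite -normrM.
  have -> : k * (k^-1 *: (sqpos (k + y) - sqpos y) - 2 * Num.max y 0) =
      sqpos (k + y) - sqpos y - k * (2 * Num.max y 0).
    by rewrite /GRing.scale/= mulrBr mulrA divff// mul1r.
  by apply: (le_trans (est k)); rewrite ler_wpM2l.
by split; [apply/cvg_ex; eexists; exact: lim|exact: cvg_lim].
Unshelve. all: by end_near. Qed.

(* Squares of positive parts give a [C^1] cutoff with an explicit derivative. *)
Definition psi t : R := 1 - sqpos (1 - sqpos (t - 1)).
Definition dpsi t : R := 2 * Num.max (1 - sqpos (t - 1)) 0 * (2 * Num.max (t - 1) 0).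

Lemma sqpos_ge0 y : 0 <= sqpos y.
Proof. exact: sqr_ge0. Qed.

Lemma sqpos_le y y' : y <= y' -> sqpos y <= sqpos y'.
Proof.
move=> yy'; have H : Num.max y 0 <= Num.max y' 0.
  by rewrite ge_max !le_max yy' lexx orbT.
by rewrite /sqpos lerXn2r// nnegrE le_max lexx orbT.
Qed.

Lemma sqpos0 y : y <= 0 -> sqpos y = 0.
Proof. by move=> y0; rewrite /sqpos max_r// expr0n. Qed.

Lemma sqpos1 : sqpos 1 = 1.
Proof. by rewrite /sqpos max_l// expr1n. Qed.

Lemma sqpos_ge1 y : 1 <= y -> 1 <= sqpos y.
Proof.
by move=> y1; rewrite -[leLHS]sqpos1; exact: sqpos_le.
Qed.

Lemma psi_le1 t : t <= 1 -> psi t = 0.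
Proof.
move=> t1; rewrite /psi (sqpos0 (y := t - 1)) ?subr_le0// subr0.
by rewrite sqpos1 subrr.
Qed.

Lemma psi_ge2 t : 2 <= t -> psi t = 1.
Proof.
move=> t2; rewrite /psi sqpos0 ?subr0// subr_le0; apply: sqpos_ge1; lra.
Qed.

Lemma psi_ge0 t : 0 <= psi t.
Proof.
rewrite /psi subr_ge0 -[leRHS]sqpos1.
by apply: sqpos_le; rewrite gerBl sqpos_ge0.
Qed.

Lemma psi_le_1 t : psi t <= 1.
Proof. by rewrite /psi gerBl sqpos_ge0. Qed.

Lemma psi_nd t t' : t <= t' -> psi t <= psi t'.
Proof.
by move=> tt'; rewrite lerD2l lerN2; apply: sqpos_le; rewrite lerD2l lerN2;
  apply: sqpos_le; rewrite lerD2r.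
Qed.

Lemma dpsi_le1 t : t <= 1 -> dpsi t = 0.
Proof. by move=> t1; rewrite /dpsi (max_r (x := t - 1)) ?subr_le0// !mulr0. Qed.

Lemma dpsi_ge2 t : 2 <= t -> dpsi t = 0.
Proof.
move=> t2; rewrite /dpsi (max_r (x := 1 - _)) ?mulr0 ?mul0r//.
by rewrite subr_le0; apply: sqpos_ge1; lra.
Qed.

Lemma dpsi_ge0 t : 0 <= dpsi t.
Proof. by rewrite !mulr_ge0// le_max lexx orbT. Qed.

(** Up to [t = 2] each of the two factors of [dpsi] is at most [2]; from there on [dpsi]
    vanishes. *)
Lemma dpsi_le4 t : dpsi t <= 4.
Proof.
have [t2|/ltW /dpsi_ge2 ->//] := leP t 2.
have -> : (4 : R) = 2 * 1 * (2 * 1) by ring.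
by rewrite /dpsi ler_pM ?mulr_ge0 ?ler_wpM2l ?ge_max ?ler01 ?andbT//
  ?le_max ?lexx ?orbT// ?gerBl ?sqpos_ge0//; lra.
Qed.

Lemma is_derive_psi t : is_derive t (1 : R) psi (dpsi t).
Proof.
have D1 : is_derive t (1 : R) (fun t => t - 1) 1.
  by apply: is_derive_eq; rewrite subr0.
have D2 := is_derive1_comp (g := fun t => t - 1) (is_derive_sqpos (t - 1)) D1.
have D3 := is_derive_fB (is_derive_cst (1 : R) t (1 : R)) D2.
have D4 := is_derive1_comp (g := fun t => 1 - sqpos (t - 1))
  (is_derive_sqpos (1 - sqpos (t - 1))) D3.
have D5 := is_derive_fB (is_derive_cst (1 : R) t (1 : R)) D4.
by apply: is_derive_eq D5 _; rewrite /dpsi; ring.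
Qed.

Lemma continuous_sqpos : continuous sqpos.
Proof.
move=> y; apply/differentiable_continuous/derivable1_diffP.
by have [] := is_derive_sqpos y.
Qed.

Lemma continuous_psi : continuous psi.
Proof.
move=> t; apply/differentiable_continuous/derivable1_diffP.
by have [] := is_derive_psi t.
Qed.

Lemma continuous_dpsi : continuous dpsi.
Proof.
have cmax : continuous (fun y => Num.max y 0 : R).
  by move=> y; apply: continuous_max; [exact: cvg_id|exact: cvg_cst].
have c1 t : {for t, continuous (fun t => t - 1 : R)}.
  by apply: cvgB; [exact: cvg_id|exact: cvg_cst].
move=> t.
have c2 : {for t, continuous (fun t => 1 - sqpos (t - 1))}.
  apply: cvgB; first exact: cvg_cst.
  exact: (@continuous_comp _ _ _ (fun t => t - 1) sqpos t (c1 t)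
    (continuous_sqpos (x := _))).
apply: cvgM; (apply: cvgM; first exact: cvg_cst).
- exact: (@continuous_comp _ _ _ _ (fun y => Num.max y 0) t c2 (cmax _)).
- exact: (@continuous_comp _ _ _ _ (fun y => Num.max y 0) t (c1 t) (cmax _)).
Qed.

(** Regularity on the open interval leaves room for [s^-2] at [0] and for [rho 1 m] at [1]. It is
    closed under sums and products, and [radial_C1_cutoff] turns it into [radial_C1]. *)
Definition C1on h dh := forall s, 0 < s < 1 ->
  is_derive s (1 : R) h (dh s) /\ {for s, continuous dh}.

Lemma C1on_continuous h dh s : C1on h dh -> 0 < s < 1 -> {for s, continuous h}.
Proof.
move=> hC s01; apply/differentiable_continuous/derivable1_diffP.
by have [[]] := hC s s01.
Qed.

Lemma C1on_cst c : C1on (fun=> c) (fun=> 0).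
Proof. by move=> s _; split; [exact: is_derive_cst|exact: cvg_cst]. Qed.

Lemma C1onM h dh g dg : C1on h dh -> C1on g dg ->
  C1on (fun s => h s * g s) (fun s => h s * dg s + g s * dh s).
Proof.
move=> hC gC s s01; have [Dh ch] := hC s s01; have [Dg cg] := gC s s01.
split; first exact: is_derive_fM.
exact: (cvgD (cvgM (C1on_continuous hC s01) cg) (cvgM (C1on_continuous gC s01) ch)).
Qed.

Lemma C1onD h dh g dg : C1on h dh -> C1on g dg ->
  C1on (fun s => h s + g s) (fun s => dh s + dg s).
Proof.
move=> hC gC s s01; have [Dh ch] := hC s s01; have [Dg cg] := gC s s01.
by split; [exact: is_derive_fD|exact: (cvgD ch cg)].
Qed.

Lemma C1on_inv : C1on (fun s => s^-1) (fun s => - (s^-1 ^+ 2)).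
Proof.
move=> s /andP[s0 _]; split.
  have D := @is_deriveV R id s 1 1 (lt0r_neq0 s0) (is_derive_id s 1).
  by apply: is_derive_eq D _; rewrite /GRing.scale/= mulr1 exprVn.
have ci : {for s, continuous (fun s => s^-1 : R)}.
  by apply: cvgV; [exact: lt0r_neq0|exact: cvg_id].
by apply: cvgN; under eq_fun do rewrite expr2; exact: (cvgM ci ci).
Qed.

(** Since [psi (K * s)] vanishes for [K * s <= 1], the product is identically zero near every
    [s <= 0], whatever values [h] takes there. *)
Lemma radial_C1_cutoff K h dh : 0 < K -> C1on h dh ->
  radial_C1 (fun s => psi (K * s) * h s)
            (fun s => psi (K * s) * dh s + K * dpsi (K * s) * h s).
Proof.
move=> K0 hC s s1.
have [s0|s0] := ltP 0 s.
  have s01 : 0 < s < 1 by rewrite s0.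
  have [Dh ch] := hC s s01.
  have DK : is_derive s (1 : R) (fun s => K * s) K.
    have := is_derive_fM (is_derive_cst K s (1 : R)) (is_derive_id s (1 : R)).
    by move/is_derive_eq; apply; rewrite mulr1 mulr0 addr0.
  have cK : {for s, continuous (fun s => K * s)}.
    by apply: cvgM; [exact: cvg_cst|exact: cvg_id].
  have cp : {for s, continuous (fun s => psi (K * s))}.
    exact: (@continuous_comp _ _ _ (fun s => K * s) psi s cK (continuous_psi (x := _))).
  have cdp : {for s, continuous (fun s => dpsi (K * s))}.
    exact: (@continuous_comp _ _ _ (fun s => K * s) dpsi s cK
      (continuous_dpsi (x := _))).
  split.
    have Dp : is_derive s (1 : R) (fun s => psi (K * s)) (dpsi (K * s) * K).
      exact: (is_derive1_comp (g := fun s => K * s) (is_derive_psi _) DK).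
    by apply: is_derive_eq (is_derive_fM Dp Dh) _; ring.
  have ck : {for s, continuous (fun s => K * dpsi (K * s))}.
    by apply: cvgM; [exact: cvg_cst|exact: cdp].
  exact: (cvgD (cvgM cp ch) (cvgM ck (C1on_continuous hC s01))).
have nK : \forall y \near s, K * y <= 1.
  near=> y; rewrite mulrC -ler_pdivlMr// div1r ltW//; near: y.
  by apply: lt_nbhsl; rewrite (le_lt_trans s0)// invr_gt0.
have Ks : K * s <= 1 by apply: (nbhs_singleton nK).
split.
  rewrite (psi_le1 Ks) (dpsi_le1 Ks) mulr0 !mul0r addr0.
  apply: (near_eq_is_derive (f := fun=> 0) _ (is_derive_cst 0 s (1 : R))).
  by apply: filterS nK => y Ky; rewrite /= (psi_le1 Ky) mul0r.
have F : Filter (nbhs s) by exact: nbhs_filter.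
apply: (@cvg_near_cst _ _ _ _ (nbhs s)).
by apply: filterS nK => y Ky; rewrite (psi_le1 Ky) (dpsi_le1 Ky)
  (psi_le1 Ks) (dpsi_le1 Ks) !mulr0 !mul0r.
Unshelve. all: by end_near. Qed.

(* In terms of [s = |x| ^ 2] this is [m / (1 - c |x| ^ m)]. *)
Definition rho (c m s : R) : R := m * (1 - c * s `^ (m / 2))^-1.

Lemma powR_lt1 a s : 0 < a -> 0 < s < 1 -> 0 < s `^ a < 1.
Proof.
move=> a0 /andP[s0 s1]; rewrite powR_gt0//=.
have -> : (1 : R) = 1 `^ a by rewrite powR1.
apply: gt0_ltr_powR => //; rewrite nnegrE//.
exact: ltW.
Qed.

Lemma rho_den_gt0 c m s : 0 <= c <= 1 -> 0 < m -> 0 < s < 1 ->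
  0 < 1 - c * s `^ (m / 2).
Proof.
move=> /andP[c0 c1] m0 s01.
have /andP[p0 p1] := powR_lt1 (divr_gt0 m0 (ltr0Sn _ 1)) s01.
by nra.
Qed.

Lemma rho_ge c m s : 0 <= c <= 1 -> 0 < m -> 0 < s < 1 -> m <= rho c m s.
Proof.
move=> c01 m0 s01; have d0 := rho_den_gt0 c01 m0 s01.
rewrite /rho ler_pdivlMr// ler_piMr ?(ltW m0)// gerBl mulr_ge0 ?powR_ge0//.
by case/andP: c01.
Qed.

(** This is the Riccati equation [E rho = rho^2 - m rho]; the factor [2^-1 * s^-1] converts
    [E = 2 s d/ds] into [d/ds]. *)
Lemma C1on_rho c m : 0 <= c <= 1 -> 0 < m ->
  C1on (rho c m) (fun s => rho c m s * (rho c m s - m) * (2^-1 * s^-1)).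
Proof.
move=> c01 m0.
have D s : 0 < s < 1 -> is_derive s (1 : R) (rho c m)
    (rho c m s * (rho c m s - m) * (2^-1 * s^-1)).
  move=> s01; have d0 := rho_den_gt0 c01 m0 s01; have /andP[s0 _] := s01.
  have D1 := is_derive_fM (is_derive_cst c s (1 : R)) (is_derive1_powR (m / 2) s0).
  have D2 := is_derive_fB (is_derive_cst (1 : R) s (1 : R)) D1.
  have D3 := @is_deriveV R _ s _ 1 (lt0r_neq0 d0) D2.
  have D4 := is_derive_fM (is_derive_cst m s (1 : R)) D3.
  apply: is_derive_eq D4 _.
  rewrite /rho powRD; last by rewrite (gt_eqF s0) implybT.
  rewrite powRN powRr1 ?(ltW s0)// /GRing.scale/=.
  by move: d0; move: (s `^ (m / 2)) => P d0; field; rewrite ?gt_eqF.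
move=> s s01; split; first exact: D.
have cr : {for s, continuous (rho c m)}.
  apply/differentiable_continuous/derivable1_diffP.
  by have [] := D s s01.
have /andP[s0 _] := s01.
have ci : {for s, continuous (fun s => s^-1 : R)}.
  by apply: cvgV; [exact: lt0r_neq0|exact: cvg_id].
apply: cvgM; last by apply: cvgM; [exact: cvg_cst|exact: ci].
by apply: cvgM; [exact: cr|apply: cvgB; [exact: cr|exact: cvg_cst]].
Qed.

End radial_profiles.

(** * Vanishing integrals with the cutoff [psi (K |x|^2)] *)

Section cutoff_null_integrals.
Context {R : realType} {N : nat}.
Implicit Types (f g : 'rV[R]_N -> R) (x : 'rV[R]_N).
Variables (K b : R).
Hypotheses (K0 : 0 < K) (b1 : b < 1).

(** The divergence integrand of [Ir_euler_weighted] for the weight [psi (K * s) * h s], with the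
    derivative of the product written out. *)
Definition euler_null (h dh : R -> R) f x : R :=
  psi (K * sqn x) * h (sqn x) * euler f x +
  (N%:R * (psi (K * sqn x) * h (sqn x)) + 2 * sqn x *
     (psi (K * sqn x) * dh (sqn x) + K * dpsi (K * sqn x) * h (sqn x))) * f x.

Definition rot_null (h : R -> R) i j f x : R :=
  psi (K * sqn x) * h (sqn x) * rot i j f x.

Lemma Ir_euler_null h dh f : C1on h dh -> Cc 1 b f ->
  nice 2 (euler_null h dh f) /\ Ir (euler_null h dh f) = 0.
Proof. by move=> hC f1; exact: (Ir_euler_weighted (radial_C1_cutoff K0 hC) b1 f1). Qed.

Lemma Ir_rot_null h dh i j f : C1on h dh -> Cc 1 b f ->
  nice 2 (rot_null h i j f) /\ Ir (rot_null h i j f) = 0.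
Proof. by move=> hC f1; exact: (Ir_rot_weighted (radial_C1_cutoff K0 hC) b1 f1). Qed.

Lemma euler_null0 h dh f x : Cc 1 b f -> ~~ (0 < sqn x < 1) -> euler_null h dh f x = 0.
Proof.
move=> f1; rewrite negb_and -!leNgt => /orP[s0|s1].
  have Ks : K * sqn x <= 1 by rewrite (le_trans _ ler01)// pmulr_rle0.
  by rewrite /euler_null psi_le1// dpsi_le1// !(mul0r, mulr0, addr0).
have bx := lt_le_trans b1 s1.
have [_ Ef] := Cc_euler f1.
by rewrite /euler_null Ef// (f1.2 x bx) !mulr0 addr0.
Qed.

Lemma rot_null0 h i j f x : Cc 1 b f -> ~~ (0 < sqn x < 1) -> rot_null h i j f x = 0.
Proof.
move=> f1; rewrite negb_and -!leNgt => /orP[s0|s1].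
  have Ks : K * sqn x <= 1 by rewrite (le_trans _ ler01)// pmulr_rle0.
  by rewrite /rot_null psi_le1// !mul0r.
by have [_ Lf] := Cc_rot i j f1; rewrite /rot_null Lf ?mulr0// (lt_le_trans b1).
Qed.

Lemma nice_cutoff h dh f : C1on h dh -> Cc 0 b f ->
  nice 2 (fun x => psi (K * sqn x) * h (sqn x) * f x).
Proof.
move=> hC f0.
have ch (s : R) : s < 1 -> {for s, continuous (fun s => psi (K * s) * h s)}.
  move=> s1; apply/differentiable_continuous/derivable1_diffP.
  by have [[]] := radial_C1_cutoff K0 hC s1.
apply: Cc_nice (continuous_weighted b1 ch f0); last by [].
by rewrite (le_trans (ltW b1))// expr2; lra.
Qed.

End cutoff_null_integrals.

(** * Pointwise algebraic identities and inequalities *)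

Section real_identities.
Context {R : realType}.
Implicit Types n m p s q P D mu nu : R.

(** Here [lap^2 = q (A + S/2)^2]. Since [P <= 1], a factor [P] may be inserted; expanding and
    discarding [P q (S/2)^2] leaves the left-hand side. *)
Lemma drop_spherical_square s q P lap A S : 0 <= P <= 1 -> 0 < q -> q * s ^+ 2 = 1 ->
  s * lap = A + 2^-1 * S -> P * q * A ^+ 2 + P * q * (A * S) <= lap ^+ 2.
Proof.
move=> /andP[P0 P1] q0 qs E.
have -> : lap ^+ 2 = q * (A + 2^-1 * S) ^+ 2.
  by rewrite -E exprMn mulrA qs mul1r.
have sq : 0 <= q * (A + 2^-1 * S) ^+ 2 by rewrite mulr_ge0 ?sqr_ge0// ltW.
apply: (@le_trans _ _ (P * (q * (A + 2^-1 * S) ^+ 2))); last by rewrite ler_piMl.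
rewrite -subr_ge0 [leRHS](_ : _ = P * (q * (2^-1 * S) ^+ 2)); last by field.
by apply: mulr_ge0 => //; apply: mulr_ge0; [exact: ltW|exact: sqr_ge0].
Qed.

(* The first three terms of the right-hand side are the integrands of [rot_null] for
   [A v] and of [euler_null] for [v E v] and [v ^ 2], with [P], [D] the values of the
   cutoff and of its image under [E], and [q = |x| ^ -4]. *)
Lemma spherical_identity n q P D A LA v Ev EEv Lv :
  LA = EEv + (n - 2) * Ev ->
  P * q * (A * Lv) =
  P * q * (A * Lv + v * LA)
  - (P * q * (v * EEv + Ev * Ev) + ((n - 4) * (P * q) + D * q) * (v * Ev))
  - (P * q * (v * Ev + v * Ev) + ((n - 4) * (P * q) + D * q) * (v * v))
  + P * q * (Ev ^+ 2 + (n - 4) * v ^+ 2) + D * q * (v * Ev + v ^+ 2).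
Proof. by move=> ->; ring. Qed.

(* The two large bracketed terms are the integrands of [euler_null] for [g ^ 2] with
   weight [|x| ^ -4 (N - 1 - mu)] and for [u ^ 2] with weight
   [|x| ^ -4 (N - 1 + m mu) nu]. *)
Lemma radial_inequality n m p q P D mu nu A g Eg u : 0 <= P -> 0 <= q ->
  m = (n - 2) / 2 -> p = (n - 4) / 2 -> 0 <= m <= mu -> 0 <= nu -> 1 <= n ->
  A = Eg + (n - 2) * g ->
  P * q * (p * ((n - 1 + m * mu) * nu)) * u ^+ 2
  + (P * q * (n - 1 - mu) * (g * Eg + g * Eg) +
      ((n - 4) * (P * q * (n - 1 - mu)) - P * q * (mu * (mu - m))
       + D * q * (n - 1 - mu)) * (g * g))
  - (P * q * ((n - 1 + m * mu) * nu) * (u * g + u * g) +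
      ((n - 4) * (P * q * ((n - 1 + m * mu) * nu))
       + P * q * (m * nu * (mu * (mu - m)) + (n - 1 + m * mu) * (nu * (nu - p)))
       + D * q * ((n - 1 + m * mu) * nu)) * (u * u))
  + D * q * ((n - 1 + m * mu) * nu * u ^+ 2 - (n - 1 - mu) * g ^+ 2)
  <= P * q * A ^+ 2.
Proof.
move=> P0 q0 mE pE /andP[m0 mmu] nu0 n1 ->.
have Pq : 0 <= P * q by rewrite mulr_ge0.
have mu0 : 0 <= mu by exact: le_trans mmu.
have th0 : 0 <= n - 1 + m * mu by rewrite addr_ge0 ?subr_ge0// mulr_ge0.
(* The first two squares are those of the method. The third term is [nu E(m mu) u^2], left over from
   differentiating the weight of [u^2]; it is nonnegative because [m <= mu]. *)
rewrite -subr_ge0 [leRHS](_ : _ = P * q * ((Eg + (mu - 1) * g) ^+ 2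
   + (n - 1 + m * mu) * (g + nu * u) ^+ 2 + m * nu * (mu * (mu - m)) * u ^+ 2)).
  apply: mulr_ge0 => //; apply: addr_ge0; first apply: addr_ge0.
  - exact: sqr_ge0.
  - by apply: mulr_ge0; [|exact: sqr_ge0].
  - by apply: mulr_ge0; [rewrite !mulr_ge0// subr_ge0|exact: sqr_ge0].
by rewrite mE pE; field.
Qed.

Lemma rho_nd (c m s s' : R) : 0 <= c <= 1 -> 0 < m -> 0 < s -> s <= s' -> s' < 1 ->
  rho c m s <= rho c m s'.
Proof.
move=> c01 m0 s0 ss' s'1.
have d0 := @rho_den_gt0 _ c m s c01 m0; have d'0 := @rho_den_gt0 _ c m s' c01 m0.
rewrite /rho ler_wpM2l ?(ltW m0)// lef_pV2 ?posrE.
- rewrite lerD2l lerN2 ler_wpM2l ?(andP c01).1//.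
  by apply: ge0_ler_powR; rewrite ?nnegrE// ?divr_ge0 ?ltW// (lt_le_trans s0).
- by apply: d0; rewrite s0 (le_lt_trans ss').
- by apply: d'0; rewrite s'1 (lt_le_trans s0).
Qed.

End real_identities.

(** * Integrands with zero integral *)

Section null_functions.
Context {R : realType} {N : nat}.
Implicit Types (F G : 'rV[R]_N -> R).

Definition null F := nice 2 F /\ Ir F = 0.

Lemma nullZD F G a : null F -> null G -> null (fun x => F x + a * G x).
Proof.
move=> [nF F0] [nG G0]; split; first exact: niceZD.
by rewrite (Ir_linear _ (ler0n _ 2))// F0 G0 mulr0 addr0.
Qed.

Lemma nullD F G : null F -> null G -> null (fun x => F x + G x).
Proof. by move=> nF nG; under eq_fun do rewrite -[X in _ + X]mul1r; exact: nullZD. Qed.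

Lemma nullB F G : null F -> null G -> null (fun x => F x - G x).
Proof. by move=> nF nG; under eq_fun do rewrite -mulN1r; exact: nullZD. Qed.

Lemma null_sum (I : Type) (r : seq I) (F : I -> 'rV[R]_N -> R) :
  (forall i, null (F i)) -> null (fun x => \sum_(i <- r) F i x).
Proof.
move=> nF; elim: r => [|i r IH].
  by under eq_fun do rewrite big_nil; split; [exact: nice0|exact: Ir0].
by under eq_fun do rewrite big_cons; exact: nullD.
Qed.

End null_functions.

(** * The inequality with a cutoff at the origin *)

Section hardy_rellich_weights.
Context {R : realType}.
Variables (n K : R).
Implicit Type s : R.

Definition hm : R := (n - 2) / 2.
Definition hp : R := (n - 4) / 2.
Definition hmu s : R := rho (9 / 10) hm s.
Definition hnu s : R := rho 1 hp s.
Definition dhmu s : R := hmu s * (hmu s - hm) * (2^-1 * s^-1).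
Definition dhnu s : R := hnu s * (hnu s - hp) * (2^-1 * s^-1).
(** The factor [|x|^-4] in terms of [s = |x|^2], as a product so that [C1onM] applies. *)
Definition isq s : R := s^-1 * s^-1.
Definition disq s : R := s^-1 * - (s^-1 ^+ 2) + s^-1 * - (s^-1 ^+ 2).
Definition kap s : R := n - 1 + -1 * hmu s.
(** This derivative and those below keep the unsimplified shape produced by [C1onD] and [C1onM], so
    that the [C1on] proofs hold by conversion. *)
Definition dkap s : R := 0 + (-1 * dhmu s + hmu s * 0).
Definition tht s : R := n - 1 + hm * hmu s.
Definition dtht s : R := 0 + (hm * dhmu s + hmu s * 0).
(** The cross term of [A^2 - (E g + (mu - 1) g)^2] is [2 (n - 1 - mu) g E g], that is [kap] times
    [E (g^2)]. *)
Definition wg s : R := isq s * kap s.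
Definition dwg s : R := isq s * dkap s + kap s * disq s.
(** The cross term of [tht (g + nu u)^2] is [2 tht nu u g], that is [tht nu] times [E (u^2)]. *)
Definition wu s : R := isq s * (tht s * hnu s).
Definition dwu s : R :=
  isq s * (tht s * dhnu s + hnu s * dtht s) + tht s * hnu s * disq s.
Definition wtot s : R := isq s * (hp * (tht s * hnu s)).

Hypothesis n5 : 5 <= n.

Lemma hm_gt0 : 0 < hm.
Proof. by rewrite divr_gt0// subr_gt0 (lt_le_trans _ n5)// ltr_nat. Qed.

Lemma hp_gt0 : 0 < hp.
Proof. by rewrite divr_gt0// subr_gt0 (lt_le_trans _ n5)// ltr_nat. Qed.

Let c01 : (0 : R) <= (9 / 10 : R) <= (1 : R). Proof. by apply/andP; split; lra. Qed.
Let one01 : (0 : R) <= (1 : R) <= (1 : R). Proof. by rewrite ler01 lexx. Qed.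

Lemma hmu_ge s : 0 < s < 1 -> hm <= hmu s.
Proof. exact: (rho_ge c01 hm_gt0). Qed.

Lemma hnu_ge s : 0 < s < 1 -> hp <= hnu s.
Proof. exact: (rho_ge one01 hp_gt0). Qed.

Lemma hmu_le s : 0 < s -> s <= 2^-1 -> hmu s <= hmu 2^-1.
Proof. by move=> s0 s2; apply: (rho_nd c01 hm_gt0) => //; lra. Qed.

Lemma hnu_le s : 0 < s -> s <= 2^-1 -> hnu s <= hnu 2^-1.
Proof. by move=> s0 s2; apply: (rho_nd one01 hp_gt0) => //; lra. Qed.

Lemma C1on_hmu : C1on hmu dhmu.
Proof. exact: (C1on_rho c01 hm_gt0). Qed.

Lemma C1on_hnu : C1on hnu dhnu.
Proof. exact: (C1on_rho one01 hp_gt0). Qed.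

Lemma C1on_isq : C1on isq disq.
Proof. exact: (C1onM (@C1on_inv R) (@C1on_inv R)). Qed.

Lemma C1on_tht : C1on tht dtht.
Proof. exact: (C1onD (C1on_cst (n - 1)) (C1onM (C1on_cst hm) C1on_hmu)). Qed.

Lemma C1on_wg : C1on wg dwg.
Proof.
exact: (C1onM C1on_isq (C1onD (C1on_cst (n - 1)) (C1onM (C1on_cst (-1)) C1on_hmu))).
Qed.

Lemma C1on_wu : C1on wu dwu.
Proof. exact: (C1onM C1on_isq (C1onM C1on_tht C1on_hnu)). Qed.

Lemma C1on_wtot : exists d, C1on wtot d.
Proof.
eexists; exact: (C1onM C1on_isq (C1onM (C1on_cst hp) (C1onM C1on_tht C1on_hnu))).
Qed.

Lemma isq_gt0 s : 0 < s -> 0 < isq s.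
Proof. by move=> s0; rewrite mulr_gt0// invr_gt0. Qed.

Lemma isqK s : 0 < s -> isq s * s ^+ 2 = 1.
Proof. by move=> s0; rewrite /isq; field; rewrite gt_eqF. Qed.

Variables (P dP : R).

(** Since [E |x|^-4 = -4 |x|^-4], the dimension [n] turns into [n - 4]. [P] and [dP] stand for [psi]
    and [dpsi] at [K * s]. *)
Lemma isq_coef s : 0 < s ->
  n * (P * isq s) + 2 * s * (P * disq s + K * dP * isq s) =
  (n - 4) * (P * isq s) + 2 * s * K * dP * isq s.
Proof. by move=> s0; rewrite /disq /isq; field; rewrite gt_eqF. Qed.

Lemma wg_coef s : 0 < s ->
  n * (P * wg s) + 2 * s * (P * dwg s + K * dP * wg s) =
  (n - 4) * (P * isq s * (n - 1 - hmu s)) - P * isq s * (hmu s * (hmu s - hm))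
    + 2 * s * K * dP * isq s * (n - 1 - hmu s).
Proof.
move=> s0; rewrite /dwg /wg /dkap /kap /dhmu /disq /isq.
by move: (hmu s) hm => mu m; field; rewrite gt_eqF.
Qed.

Lemma wu_coef s : 0 < s ->
  n * (P * wu s) + 2 * s * (P * dwu s + K * dP * wu s) =
  (n - 4) * (P * isq s * ((n - 1 + hm * hmu s) * hnu s))
   + P * isq s * (hm * hnu s * (hmu s * (hmu s - hm))
        + (n - 1 + hm * hmu s) * (hnu s * (hnu s - hp)))
   + 2 * s * K * dP * isq s * ((n - 1 + hm * hmu s) * hnu s).
Proof.
move=> s0; rewrite /dwu /wu /dtht /tht /dhmu /dhnu /disq /isq.
by move: (hmu s) (hnu s) hm hp => mu nu m p; field; rewrite gt_eqF.
Qed.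

End hardy_rellich_weights.

(** * The integrated inequality with cutoff and its error term *)

Section main_inequality.
Context {R : realType} {N : nat}.
Variables (u : 'rV[R]_N -> R) (b : R).
Hypotheses (N5 : (5 <= N)%N) (u4 : Cc 4 b u) (b1 : b < 1).
Implicit Type x : 'rV[R]_N.
Local Notation n := (N%:R : R).

Let n5 : 5 <= n. Proof. by rewrite ler_nat. Qed.

Let g := euler u.
Let A x := euler g x + (n - 2) * g x.
Let v (z : 'I_N * 'I_N) := rot z.1 z.2 u.

Let g3 : Cc 3 b g. Proof. exact: Cc_euler. Qed.
Let v3 z : Cc 3 b (v z). Proof. exact: Cc_rot. Qed.
Let Ev2 z : Cc 2 b (euler (v z)). Proof. exact: Cc_euler. Qed.
Let A2 : Cc 2 b A.
Proof.
apply: CcD; first exact: Cc_euler.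
by apply: CcM; [exact: Ck_cst|exact: Cc_le g3].
Qed.

Let Av1 z : Cc 1 b (fun x => A x * v z x).
Proof. by apply: CcM; [exact: (Ck_le _ A2.1)|exact: Cc_le (v3 z)]. Qed.
Let vEv1 z : Cc 1 b (fun x => v z x * euler (v z) x).
Proof. by apply: CcM; [exact: (Ck_le _ (v3 z).1)|exact: Cc_le (Ev2 z)]. Qed.
Let vv1 z : Cc 1 b (fun x => v z x * v z x).
Proof. by apply: CcM; [exact: (Ck_le _ (v3 z).1)|exact: Cc_le (v3 z)]. Qed.
Let gg1 : Cc 1 b (fun x => g x * g x).
Proof. by apply: CcM; [exact: (Ck_le _ g3.1)|exact: Cc_le g3]. Qed.
Let uu1 : Cc 1 b (fun x => u x * u x).
Proof. by apply: CcM; [exact: (Ck_le _ u4.1)|exact: Cc_le u4]. Qed.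

(** The total factor of the [D * q] terms, from [spherical_identity] summed over all pairs and from
    [radial_inequality]. *)
Let brk x : R := \sum_z (v z x * euler (v z) x + v z x ^+ 2)
   + ((n - 1 + hm n * hmu n (sqn x)) * hnu n (sqn x) * u x ^+ 2
      - (n - 1 - hmu n (sqn x)) * g x ^+ 2).

Let Cc_bounded f : Cc 1 b f -> exists M : R, 0 <= M /\ forall x, `|f x| <= M.
Proof.
move=> f1; have b2 : b <= 2 ^+ 2 by rewrite (le_trans (ltW b1))// expr2; lra.
have [_ [M fM] _] := Cc_nice b2 (ler0n _ _) f1.
by exists M; split => //; exact: le_trans (fM 0).
Qed.

(** [u], [g] and the [v z] give bounded terms. The restriction to [s <= 2^-1] keeps away from the
    blow-up of [nu] at [1]; there [mu] and [nu], being nondecreasing, are at most their values at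
    [2^-1]. *)
Let brk_bound : exists C, 0 <= C /\
  forall x, 0 < sqn x -> sqn x <= 2^-1 -> `|brk x| <= C.
Proof.
have S1 : Cc 1 b (fun x => \sum_z (v z x * euler (v z) x + v z x * v z x)).
  split; first by apply: Ck_sum => z; exact: (CcD (vEv1 z) (vv1 z)).1.
  by move=> x bx; apply: big1 => z _; exact: (CcD (vEv1 z) (vv1 z)).2.
have [M1 [M10 SM]] := Cc_bounded S1.
have [M2 [M20 gM]] := Cc_bounded gg1.
have [M3 [M30 uM]] := Cc_bounded uu1.
have half01 : (0 : R) < 2^-1 < (1 : R) by apply/andP; split; lra.
have m0 := hm_gt0 n5; have p0 := hp_gt0 n5.
have mh := hmu_ge n5 half01; have ph := hnu_ge n5 half01.
have n1 : 0 <= n - 1 by rewrite subr_ge0; apply: le_trans n5; lra.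
exists (M1 + ((n - 1 + hm n * hmu n 2^-1) * hnu n 2^-1 * M3
  + (n - 1 + hmu n 2^-1) * M2)).
have mu0 : 0 <= hmu n 2^-1 by exact: le_trans (ltW m0) mh.
have nu0 : 0 <= hnu n 2^-1 by exact: le_trans (ltW p0) ph.
split.
  apply: addr_ge0 => //; apply: addr_ge0; apply: mulr_ge0 => //.
    by apply: mulr_ge0 => //; apply: addr_ge0 => //; apply: mulr_ge0 => //; exact: ltW.
  exact: addr_ge0.
move=> x s0 s2; have x01 : 0 < sqn x < 1 by rewrite s0; lra.
have mx := hmu_ge n5 x01; have px := hnu_ge n5 x01.
have mx' := hmu_le n5 s0 s2; have px' := hnu_le n5 s0 s2.
have mux0 : 0 <= hmu n (sqn x) by exact: le_trans (ltW m0) mx.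
have nux0 : 0 <= hnu n (sqn x) by exact: le_trans (ltW p0) px.
apply: le_trans (ler_normD _ _) _; apply: lerD.
  by under eq_bigr do rewrite expr2; exact: SM.
apply: le_trans (ler_normB _ _) _; rewrite !expr2; apply: lerD.
  rewrite normrM; apply: ler_pM => //.
  have th0 y : 0 <= y -> 0 <= n - 1 + hm n * y.
    by move=> y0; apply: addr_ge0 => //; apply: mulr_ge0 => //; exact: ltW.
  rewrite ger0_norm; last by apply: mulr_ge0 => //; exact: th0.
  apply: ler_pM => //; first exact: th0.
  by rewrite lerD2l; apply: ler_wpM2l => //; exact: ltW.
rewrite normrM; apply: ler_pM => //.
apply: le_trans (ler_normB _ _) _.
by rewrite (ger0_norm n1) (ger0_norm mux0) lerD2l.
Qed.

Section cutoff.
Variable K : R.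
Hypothesis K0 : 0 < K.

(** All the exact derivatives of the method, with the signs of [spherical_identity] and
    [radial_inequality]; adding [F] to an integrand leaves its integral unchanged. *)
Let F x : R := \sum_(z : 'I_N * 'I_N)
    (rot_null K isq z.1 z.2 (fun x => A x * v z x) x
     - euler_null K isq disq (fun x => v z x * euler (v z) x) x
     - euler_null K isq disq (fun x => v z x * v z x) x)
  + euler_null K (wg n) (dwg n) (fun x => g x * g x) x
  - euler_null K (wu n) (dwu n) (fun x => u x * u x) x.

Let F_null : null F.
Proof.
apply: nullB; last exact: (Ir_euler_null K0 b1 (C1on_wu n5) uu1).
apply: nullD; last exact: (Ir_euler_null K0 b1 (C1on_wg n5) gg1).
apply: null_sum => z; apply: nullB.
  apply: nullB; last exact: (Ir_euler_null K0 b1 (@C1on_isq R) (vEv1 z)).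
  exact: (Ir_rot_null K0 b1 z.1 z.2 (@C1on_isq R) (Av1 z)).
exact: (Ir_euler_null K0 b1 (@C1on_isq R) (vv1 z)).
Qed.

Let F0 x : ~~ (0 < sqn x < 1) -> F x = 0.
Proof.
move=> x01; rewrite /F big1 => [|z _].
  by rewrite !(euler_null0 K0 b1)// add0r subrr.
by rewrite (rot_null0 K0 b1)// !(euler_null0 K0 b1)// !subrr.
Qed.

(** Rotations commute with [E], so applying one to [A = E E u + (n - 2) E u] puts [v z] in place of
    [u]. *)
Let LA z x : rot z.1 z.2 A x = euler (euler (v z)) x + (n - 2) * euler (v z) x.
Proof.
have Lg : rot z.1 z.2 g = euler (v z).
  by apply/funext => y; rewrite euler_rot//; exact: (Ck_le _ u4.1).
rewrite -Lg euler_rot; last exact: (Ck_le _ g3.1).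
have Eg := Ck_euler g3.1.
have D i := is_derive_fD (Ck_is_derive i x Eg) (is_derive_fM
  (is_derive_cst (n - 2) x (ebasis R i)) (Ck_is_derive i x g3.1)).
have E i : 'D_(ebasis R i) A x = 'D_(ebasis R i) (euler g) x +
    (n - 2) * 'D_(ebasis R i) g x.
  by apply: (etrans (@derive_val _ _ _ _ _ _ _ (D i))); rewrite mulr0 addr0.
rewrite /rot !E.
move: ('D_(ebasis R z.2) (euler g) x) ('D_(ebasis R z.1) (euler g) x)
  ('D_(ebasis R z.2) g x) ('D_(ebasis R z.1) g x) => *; ring.
Qed.

(* What the derivative of the cutoff contributes. *)
Let err x : R := 2 * sqn x * K * dpsi (K * sqn x) * isq (sqn x) * brk x.

(** [drop_spherical_square] splits the squared Laplacian into a radial and a mixed part;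
    [radial_inequality] bounds the first from below, and the sum over [z] of [spherical_identity]
    rewrites the second. *)
Let pointwise x : 0 < sqn x < 1 ->
  psi (K * sqn x) * isq (sqn x) *
    (hp n * ((n - 1 + hm n * hmu n (sqn x)) * hnu n (sqn x))) * u x ^+ 2
  + F x + err x <= laplacian u x ^+ 2.
Proof.
move=> x01; have /andP[s0 s1] := x01.
have EM f f' := @eulerM R N f f' x.
(* One ordered pair [z] contributes here; the factor [2] of the cross term cancels the [2^-1] in
   [S], so the sum over all pairs appears with coefficient [1]. *)
have sph z : psi (K * sqn x) * isq (sqn x) * (A x * rot z.1 z.2 (v z) x) =
    (rot_null K isq z.1 z.2 (fun x => A x * v z x) x
     - euler_null K isq disq (fun x => v z x * euler (v z) x) x
     - euler_null K isq disq (fun x => v z x * v z x) x)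
    + psi (K * sqn x) * isq (sqn x) * (euler (v z) x ^+ 2 + (n - 4) * v z x ^+ 2)
    + 2 * sqn x * K * dpsi (K * sqn x) * isq (sqn x) *
        (v z x * euler (v z) x + v z x ^+ 2).
  apply: etrans (spherical_identity (isq (sqn x)) (psi (K * sqn x))
    (2 * sqn x * K * dpsi (K * sqn x)) (A x) (v z x) (rot z.1 z.2 (v z) x)
    (LA z x)) _.
  congr (_ - _ - _ + _ + _).
  - congr (_ * _); apply/esym/rotM; first exact: (Ck_le _ A2.1).
    exact: (Ck_le _ (v3 z).1).
  - rewrite /euler_null isq_coef//; congr (_ * _ + _); apply/esym/EM.
      exact: (Ck_le _ (v3 z).1).
    exact: (Ck_le _ (Ev2 z).1).
  - by rewrite /euler_null isq_coef//; congr (_ * _ + _); apply/esym/EM;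
      exact: (Ck_le _ (v3 z).1).
have rad := @radial_inequality R n (hm n) (hp n) (isq (sqn x)) (psi (K * sqn x))
  (2 * sqn x * K * dpsi (K * sqn x)) (hmu n (sqn x)) (hnu n (sqn x))
  (A x) (g x) (euler g x) (u x) (psi_ge0 _) (ltW (isq_gt0 s0)) erefl erefl.
have {}rad := rad _ _ _ erefl.
have hmx := hmu_ge n5 x01; have hnx := hnu_ge n5 x01.
have {rad} := rad _ _ _.
rewrite (ltW (hm_gt0 n5)) hmx (le_trans (ltW (hp_gt0 n5)) hnx) => /(_ isT isT).
have n1 : 1 <= n by apply: le_trans n5; lra.
move=> /(_ n1) rad.
have polar : sqn x * laplacian u x =
    A x + 2^-1 * \sum_(i < N) \sum_(j < N) rot i j (rot i j u) x.
  exact: laplacian_polar x (Ck_le (isT : (2 <= 4)%N) u4.1).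
have P01 : 0 <= psi (K * sqn x) <= 1 by rewrite psi_ge0 psi_le_1.
have sphS : psi (K * sqn x) * isq (sqn x) *
      (A x * \sum_(i < N) \sum_(j < N) rot i j (rot i j u) x) =
    \sum_z (rot_null K isq z.1 z.2 (fun x => A x * v z x) x
     - euler_null K isq disq (fun x => v z x * euler (v z) x) x
     - euler_null K isq disq (fun x => v z x * v z x) x)
    + psi (K * sqn x) * isq (sqn x) *
        \sum_z (euler (v z) x ^+ 2 + (n - 4) * v z x ^+ 2)
    + 2 * sqn x * K * dpsi (K * sqn x) * isq (sqn x) *
        \sum_z (v z x * euler (v z) x + v z x ^+ 2).
  rewrite (pair_bigA _ (fun i j => rot i j (rot i j u) x)) /=.
  rewrite [A x * _]mulr_sumr [LHS]mulr_sumr.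
  apply: etrans (eq_bigr _ (fun z _ => sph z)) _.
  by rewrite big_split big_split /= -!mulr_sumr.
have := drop_spherical_square P01 (isq_gt0 s0) (isqK s0) polar.
apply: le_trans.
rewrite sphS.
have wgE : euler_null K (wg n) (dwg n) (fun x => g x * g x) x =
   psi (K * sqn x) * isq (sqn x) * (n - 1 - hmu n (sqn x)) *
     (g x * euler g x + g x * euler g x) +
   ((n - 4) * (psi (K * sqn x) * isq (sqn x) * (n - 1 - hmu n (sqn x)))
    - psi (K * sqn x) * isq (sqn x) * (hmu n (sqn x) * (hmu n (sqn x) - hm n))
    + 2 * sqn x * K * dpsi (K * sqn x) * isq (sqn x) * (n - 1 - hmu n (sqn x)))
   * (g x * g x).
  rewrite /euler_null wg_coef//; congr (_ + _); rewrite /wg /kap mulN1r mulrA.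
  by congr (_ * _); apply: EM; exact: (Ck_le _ g3.1).
have wuE : euler_null K (wu n) (dwu n) (fun x => u x * u x) x =
   psi (K * sqn x) * isq (sqn x) * ((n - 1 + hm n * hmu n (sqn x)) * hnu n (sqn x)) *
     (u x * g x + u x * g x) +
   ((n - 4) * (psi (K * sqn x) * isq (sqn x) *
       ((n - 1 + hm n * hmu n (sqn x)) * hnu n (sqn x)))
    + psi (K * sqn x) * isq (sqn x) *
       (hm n * hnu n (sqn x) * (hmu n (sqn x) * (hmu n (sqn x) - hm n))
        + (n - 1 + hm n * hmu n (sqn x)) * (hnu n (sqn x) * (hnu n (sqn x) - hp n)))
    + 2 * sqn x * K * dpsi (K * sqn x) * isq (sqn x) *
        ((n - 1 + hm n * hmu n (sqn x)) * hnu n (sqn x)))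
   * (u x * u x).
  rewrite /euler_null wu_coef//; congr (_ + _); rewrite /wu /tht mulrA.
  by congr (_ * _); apply: EM; exact: (Ck_le _ u4.1).
(* The angular terms are discarded; their sign relies on [n >= 4]. *)
have sphpos : 0 <= psi (K * sqn x) * isq (sqn x) *
    \sum_z (euler (v z) x ^+ 2 + (n - 4) * v z x ^+ 2).
  apply: mulr_ge0.
    by apply: mulr_ge0; [exact: psi_ge0|exact: ltW (isq_gt0 s0)].
  apply: sumr_ge0 => z _; apply: addr_ge0; first exact: sqr_ge0.
  apply: mulr_ge0; last exact: sqr_ge0.
  by rewrite subr_ge0; apply: le_trans n5; lra.
move: rad; rewrite -wgE -wuE /err /brk /F.
(* With sums and null integrands generalised to atoms and the common factors distributed, what
   remains is linear. *)
move: sphpos; move: (\sum_z (euler _ x ^+ 2 + _)) (\sum_z (v _ x * _ + _))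
  (\sum_z (rot_null _ _ _ _ _ _ - _ - _)) (euler_null _ (wg n) _ _ _)
  (euler_null _ (wu n) _ _ _) => S1 S2 S3 e1 e2.
move: (psi _ * isq _ * S1) (2 * sqn x * K * dpsi _ * isq _) => c1 c2 c10.
rewrite mulrDr.
move: (A x) (g x) (u x) => a0 g0 u0; lra.
Qed.

(** A continuous majorant on [t >= 0] of the indicator of [t <= 2], supported there in [t <= 3];
    continuity makes it [nice], so its integral is controlled by the volume of a cube. *)
Definition tent t : R := Num.max 0 (Num.min 1 (3 - t)).

Lemma nice_tent L : 0 <= L -> 3 <= K * L ^+ 2 ->
  nice L (fun x : 'rV[R]_N => tent (K * sqn x)).
Proof.
move=> L0 KL; apply: compact_supp_nice.
  move=> x.
  have cc c : {for x, continuous (fun _ : 'rV[R]_N => c : R)} by exact: cst_continuous.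
  have c1 : {for x, continuous (fun x : 'rV[R]_N => 3 - K * sqn x)}.
    exact: (cvgB (cc 3) (cvgM (cc K) (@continuous_sqn R N x))).
  exact: (continuous_max (cc 0) (continuous_min (cc 1) c1)).
move=> x Lx; rewrite /tent max_l//; apply: (@le_trans _ _ (3 - K * sqn x)).
  by rewrite ge_min lexx orbT.
rewrite subr_le0; apply: le_trans KL _; apply: ler_wpM2l; first exact: ltW.
apply: le_trans (normr_sqn x); rewrite lerXn2r// ?nnegrE//; exact: ltW.
Qed.

Lemma tent_ge0 t : 0 <= tent t.
Proof. by rewrite /tent le_max lexx. Qed.

Lemma tent_le1 t : tent t <= 1.
Proof. by rewrite /tent ge_max ler01 ge_min lexx. Qed.

Let tent1 t : t <= 2 -> tent t = 1.
Proof. by move=> t2; rewrite /tent min_l ?max_r//; lra. Qed.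

(** The error lives on [1 < K s < 2], where [dpsi <= 4] and [s^-1 <= K]; hence the factor
    [2 * K * 4 * K = 8 * K ^+ 2]. *)
Let err_bound C x : 0 <= C ->
  (forall x, 0 < sqn x -> sqn x <= 2^-1 -> `|brk x| <= C) ->
  4 <= K -> 0 < sqn x < 1 -> - (8 * K ^+ 2 * C * tent (K * sqn x)) <= err x.
Proof.
move=> C0 bC K4 /andP[s0 s1].
have rhs0 : 0 <= 8 * K ^+ 2 * C * tent (K * sqn x).
  by rewrite !mulr_ge0 ?tent_ge0 ?exprn_ge0// ltW.
have [Ks1|Ks1] := leP (K * sqn x) 1.
  by rewrite /err dpsi_le1// mulr0 !mul0r oppr_le0.
have [Ks2|Ks2] := leP 2 (K * sqn x).
  by rewrite /err dpsi_ge2// mulr0 !mul0r oppr_le0.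
rewrite tent1 ?(ltW Ks2)// mulr1.
(* From [K s < 2] and [4 <= K]; this is where the bound on [brk] becomes available. *)
have s2 : sqn x <= 2^-1 by nra.
rewrite lerNl; apply: le_trans (ler_norm _) _.
rewrite normrN /err normrM; apply: ler_pM => //; last exact: bC.
have -> : 2 * sqn x * K * dpsi (K * sqn x) * isq (sqn x) =
    2 * K * dpsi (K * sqn x) * (sqn x)^-1.
  by rewrite /isq; field; rewrite gt_eqF.
have is0 : 0 <= (sqn x)^-1 by rewrite invr_ge0 ltW.
have isK : (sqn x)^-1 <= K.
  by rewrite -[leLHS]mul1r ler_pdivrMr// ltW.
have KK : 0 <= 2 * K * dpsi (K * sqn x).
  by apply: mulr_ge0; [apply: mulr_ge0 => //; exact: ltW|exact: dpsi_ge0].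
rewrite ger0_norm; last exact: mulr_ge0.
have -> : 8 * K ^+ 2 = 2 * K * 4 * K by ring.
apply: ler_pM => //; apply: ler_wpM2l; last exact: dpsi_le4.
by apply: mulr_ge0 => //; exact: ltW.
Qed.

Lemma nice_laplacian2 : nice 2 (fun x => laplacian u x ^+ 2).
Proof.
have l2 : Cc 2 b (laplacian u) by exact: Cc_laplacian.
have b2 : b <= 2 ^+ 2 by rewrite (le_trans (ltW b1))// expr2; lra.
under eq_fun do rewrite expr2.
exact: (Cc_nice b2 (ler0n _ _) (CcM l2.1 l2)).
Qed.

Lemma nice_cutoff_sq w d : C1on w d ->
  nice 2 (fun x => psi (K * sqn x) * w (sqn x) * u x ^+ 2).
Proof.
move=> wC; under eq_fun do rewrite expr2.
exact: (nice_cutoff K0 b1 wC (Cc_le (leq0n 1) uu1)).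
Qed.

(** [pointwise] is integrated after adding the null integrand [F] and estimating the error by
    [err_bound]. Off the punctured unit ball the left integrand and [F] vanish. *)
Lemma Ir_cutoff_le C : 0 <= C ->
  (forall x, 0 < sqn x -> sqn x <= 2^-1 -> `|brk x| <= C) -> 4 <= K ->
  Ir (fun x => psi (K * sqn x) * wtot n (sqn x) * u x ^+ 2) <=
  Ir (fun x => laplacian u x ^+ 2) +
    8 * K ^+ 2 * C * Ir (fun x : 'rV[R]_N => tent (K * sqn x)).
Proof.
move=> C0 bC K4.
have [d wC] := C1on_wtot n5; have nT := nice_cutoff_sq wC.
have nt : nice 2 (fun x : 'rV[R]_N => tent (K * sqn x)).
  by apply: nice_tent; lra.
have [nF IF] := F_null.
have nFt := niceZD (- (8 * K ^+ 2 * C)) nF nt.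
have n20 := ler0n R 2.
rewrite -[leLHS]addr0 -IF -lerBlDr.
have -> : Ir (fun x => psi (K * sqn x) * wtot n (sqn x) * u x ^+ 2) + Ir F -
    8 * K ^+ 2 * C * Ir (fun x : 'rV[R]_N => tent (K * sqn x)) =
  Ir (fun x => psi (K * sqn x) * wtot n (sqn x) * u x ^+ 2 +
     1 * (F x + (- (8 * K ^+ 2 * C)) * tent (K * sqn x))).
  by rewrite (Ir_linear _ n20 nT nFt) (Ir_linear _ n20 nF nt) mul1r mulNr addrA.
apply: (Ir_le n20 (niceZD 1 nT nFt) nice_laplacian2) => x.
rewrite mul1r mulNr.
have [x01|x01] := boolP (0 < sqn x < 1).
  apply: le_trans (pointwise x01); rewrite addrA; apply: lerD; last exact: err_bound.
  by rewrite /wtot /tht !mulrA.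
have Tx0 : psi (K * sqn x) * wtot n (sqn x) * u x ^+ 2 = 0.
  move: x01; rewrite negb_and -!leNgt => /orP[s0|s1].
    by rewrite psi_le1 ?mul0r// (le_trans _ ler01)// pmulr_rle0.
  by rewrite u4.2 ?expr0n ?mulr0// (lt_le_trans b1).
rewrite Tx0 F0// !add0r (le_trans _ (sqr_ge0 _))// oppr_le0.
by rewrite !mulr_ge0 ?tent_ge0 ?exprn_ge0// ltW.
Qed.

End cutoff.

Lemma Ir_cutoff_bound : exists C, forall k : nat,
  Ir (fun x => psi (k.+2%:R ^+ 2 * sqn x) * wtot n (sqn x) * u x ^+ 2) <=
  Ir (fun x => laplacian u x ^+ 2) + C / k.+2%:R.
Proof.
have [C [C0 bC]] := brk_bound.
exists (8 * C * 4 ^+ N) => k.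
set r : R := k.+2%:R.
(* The error is at most [8 C r ^ 4] on a cube of volume [(4 / r) ^ N], and [N > 4]. *)
have r0 : 0 < r by rewrite ltr0n.
(* The shift in [k.+2] gives [r >= 2], hence [K = r ^+ 2 >= 4] as [Ir_cutoff_le] requires. *)
have r2 : 2 <= r by rewrite ler_nat.
have K0 : 0 < r ^+ 2 by rewrite exprn_gt0.
have K4 : 4 <= r ^+ 2 by rewrite expr2; nra.
apply: le_trans (Ir_cutoff_le K0 C0 bC K4) _; rewrite lerD2l.
have L0 : 0 <= 2 / r by rewrite divr_ge0// ltW.
(* The radius matches the cutoff scale: [r^2 (2 / r)^2 = 4] exceeds [3], beyond which [tent] is
   zero. *)
have nt : nice (2 / r) (fun x : 'rV[R]_N => tent (r ^+ 2 * sqn x)).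
  apply: nice_tent => //.
  have -> : r ^+ 2 * (2 / r) ^+ 2 = 4 by field; rewrite gt_eqF.
  lra.
have It : Ir (fun x : 'rV[R]_N => tent (r ^+ 2 * sqn x)) <= (4 / r) ^+ N.
  apply: le_trans (ler_norm _) _.
  have := @Ir_bound _ N (2 / r) _ 1 L0 nt _.
  have -> : (2 / r) *+ 2 = 4 / r by rewrite -mulr_natr; field; rewrite gt_eqF.
  rewrite mul1r.
  by apply => x; rewrite ger0_norm ?tent_ge0 ?tent_le1.
have C8 : 0 <= 8 * (r ^+ 2) ^+ 2 * C by rewrite !mulr_ge0 ?exprn_ge0// ltW.
apply: le_trans (ler_wpM2l C8 It) _.
have -> : 8 * (r ^+ 2) ^+ 2 * C * (4 / r) ^+ N =
    8 * C * 4 ^+ N * ((r ^+ 2) ^+ 2 / r ^+ N).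
  by rewrite expr_div_n; ring.
apply: ler_wpM2l; first by rewrite !mulr_ge0// exprn_ge0.
rewrite -exprM ler_pdivrMr ?exprn_gt0// -ler_pdivrMl ?invr_gt0// invrK -exprS.
by rewrite ler_eXn2l//; lra.
Qed.

End main_inequality.

(** * Removing the cutoff *)

Section removing_the_cutoff.
Context {R : realType} {N : nat}.
Variables (u : 'rV[R]_N -> R) (b : R).
Hypotheses (u4 : Cc 4 b u) (b1 : b < 1).
Implicit Type x : 'rV[R]_N.

Lemma enormE x : enorm x = Num.sqrt (sqn x).
Proof. by []. Qed.

Lemma enorm_lt1 x : (enorm x < 1) = (sqn x < 1).
Proof. by rewrite enormE -[X in _ < X = _]sqrtr1 ltr_sqrt. Qed.

Definition cut_integral (w : R -> R) (k : nat) : R :=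
  Ir (fun x => psi (k.+2%:R ^+ 2 * sqn x) * w (sqn x) * u x ^+ 2).

Let K_gt0 k : (0 : R) < k.+2%:R ^+ 2.
Proof. by rewrite exprn_gt0// ltr0n. Qed.

Let n20 : (0 : R) <= 2. Proof. exact: ler0n. Qed.

Let K_nd j k : (j <= k)%N -> (j.+2%:R ^+ 2 : R) <= k.+2%:R ^+ 2.
Proof. by move=> jk; rewrite lerXn2r ?nnegrE ?ler0n// ler_nat. Qed.

Lemma cut_outside w k x : ~~ (0 < sqn x < 1) ->
  psi (k.+2%:R ^+ 2 * sqn x) * w (sqn x) * u x ^+ 2 = 0.
Proof.
rewrite negb_and -!leNgt => /orP[s0|s1].
  by rewrite psi_le1 ?mul0r// (le_trans _ ler01)// pmulr_rle0.
by rewrite u4.2 ?expr0n ?mulr0// (lt_le_trans b1).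
Qed.

Lemma cut_integral_ge0 w k : (forall s, 0 < s < 1 -> 0 <= w s) -> 0 <= cut_integral w k.
Proof.
move=> w0; apply: Ir_ge0 => x.
have [x01|x01] := boolP (0 < sqn x < 1); last by rewrite cut_outside.
apply: mulr_ge0; last exact: sqr_ge0.
by apply: mulr_ge0; [exact: psi_ge0|exact: w0].
Qed.

Lemma cut_integral_nd w d j k : C1on w d -> (forall s, 0 < s < 1 -> 0 <= w s) ->
  (j <= k)%N -> cut_integral w j <= cut_integral w k.
Proof.
move=> wC w0 jk; have nc i := nice_cutoff_sq u4 b1 (K_gt0 i) wC.
apply: (Ir_le n20 (nc j) (nc k)) => x.
have [x01|x01] := boolP (0 < sqn x < 1); last by rewrite !cut_outside.
apply: ler_wpM2r; first exact: sqr_ge0.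
apply: ler_wpM2r; first exact: w0.
by apply: psi_nd; apply: ler_wpM2r; [exact: sqn_ge0|exact: K_nd].
Qed.

(** The cutoffs increase to [1] off the origin, so monotone convergence applies. At the origin every
    cutoff is [0], so the limit is the integral of [G] only if [G] is [0] there too. *)
Lemma cut_integral_cvg w d (G : 'rV[R]_N -> R) :
  C1on w d -> (forall s, 0 < s < 1 -> 0 <= w s) ->
  (forall x, 0 < sqn x < 1 -> G x = w (sqn x) * u x ^+ 2) ->
  (forall x, sqn x = 0 -> G x = 0) ->
  (cut_integral w k)%:E @[k --> \oo] --> integral_B G.
Proof.
move=> wC w0 G01 G0; have nc i := nice_cutoff_sq u4 b1 (K_gt0 i) wC.
apply: (integralRN_cvg n20 nc).
- move=> k x; have [x01|x01] := boolP (0 < sqn x < 1); last by rewrite cut_outside.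
  apply: mulr_ge0; last exact: sqr_ge0.
  by apply: mulr_ge0; [exact: psi_ge0|exact: w0].
- move=> x j k jk.
  have [x01|x01] := boolP (0 < sqn x < 1); last by rewrite !cut_outside.
  apply: ler_wpM2r; first exact: sqr_ge0.
  apply: ler_wpM2r; first exact: w0.
  by apply: psi_nd; apply: ler_wpM2r; [exact: sqn_ge0|exact: K_nd].
move=> x; rewrite enorm_lt1; have [x01|x01] := boolP (0 < sqn x < 1).
  have /andP[s0 s1] := x01; rewrite s1 G01//.
  apply: cvg_near_cst; near=> k; congr EFin; rewrite psi_ge2 ?mul1r//.
  (* Since [k.+2 <= k.+2 ^ 2], this yields [2 <= k.+2 ^ 2 * sqn x], where [psi] equals [1]. *)
  have : 2 / sqn x <= k.+2%:R.
    apply: (@le_trans _ _ k%:R); last by rewrite ler_nat -addn2 leq_addr.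
    by near: k; exact: nbhs_infty_ger.
  rewrite ler_pdivrMr// => /le_trans; apply; apply: ler_wpM2r; first exact: ltW.
  by rewrite expr2 ler_peMl// ler1n.
have -> : (if sqn x < 1 then (G x)%:E else 0%E) = 0%E.
  case: ifPn => // s1; rewrite G0//; apply/eqP; rewrite eq_le sqn_ge0 andbT.
  by move: x01; rewrite s1 andbT -leNgt.
by apply: cvg_near_cst; near=> k; rewrite cut_outside.
Unshelve. all: by end_near. Qed.

End removing_the_cutoff.

(** The limits may a priori be infinite; nonnegativity makes their sum well defined, and a bound on
    all real terms passes to the limit. *)
Lemma cvge_combination_le (R : realType) (a c M : R) (F G : nat -> R) (I J : \bar R) :
  0 <= a -> 0 <= c -> (forall k, 0 <= F k) -> (forall k, 0 <= G k) ->
  (F k)%:E @[k --> \oo] --> I -> (G k)%:E @[k --> \oo] --> J ->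
  (forall k, a * F k + c * G k <= M) ->
  (a%:E * I + c%:E * J <= M%:E)%E.
Proof.
move=> a0 c0 F0 G0 FI GJ FGM.
have I0 : (0 <= I)%E by apply: (cvge_to_ge FI); apply: nearW => k; rewrite lee_fin.
have J0 : (0 <= J)%E by apply: (cvge_to_ge GJ); apply: nearW => k; rewrite lee_fin.
have aF : (a%:E * (F k)%:E @[k --> \oo] --> a%:E * I)%E by exact: cvgeZl.
have cG : (c%:E * (G k)%:E @[k --> \oo] --> c%:E * J)%E by exact: cvgeZl.
have aI0 : (0 <= a%:E * I)%E by rewrite mule_ge0.
have cJ0 : (0 <= c%:E * J)%E by rewrite mule_ge0.
have IJ : (a%:E * I +? c%:E * J)%E by apply: ge0_adde_def; rewrite inE.
apply: (cvge_to_le (cvgeD IJ aF cG)).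
by apply: nearW => k /=; rewrite -!EFinM -EFinD lee_fin.
Qed.

(** * Identification of the weights and passage to the limit *)

Section hardy_rellich_inequality.
Context {R : realType} {N : nat}.
Variables (u : 'rV[R]_N -> R) (b : R).
Hypotheses (N5 : (5 <= N)%N) (u4 : Cc 4 b u) (b1 : b < 1).
Implicit Types (x : 'rV[R]_N) (s : R).
Local Notation n := (N%:R : R).

Let n5 : 5 <= n. Proof. by rewrite ler_nat. Qed.
Let m0 : 0 < hm n. Proof. exact: hm_gt0. Qed.
Let p0 : 0 < hp n. Proof. exact: hp_gt0. Qed.

Let n20 : (0 : R) <= 2. Proof. exact: ler0n. Qed.

Let mu0 s : 0 < s < 1 -> 0 <= hmu n s.
Proof. by move=> s01; apply: le_trans (hmu_ge n5 s01); exact: ltW. Qed.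

Let nu0 s : 0 < s < 1 -> 0 <= hnu n s.
Proof. by move=> s01; apply: le_trans (hnu_ge n5 s01); exact: ltW. Qed.

Let isq0 s : 0 < s < 1 -> 0 <= isq s.
Proof. by move=> /andP[s0 _]; apply: ltW; exact: isq_gt0. Qed.

(** Dividing by [m p] removes the numerators of [mu] and [nu], leaving the two denominators of the
    first weight; see [weight1E]. *)
Definition weight1 (s : R) : R := (hm n * hp n)^-1 * (isq s * (hmu n s * hnu n s)).
Definition weight2 (s : R) : R := (hp n)^-1 * (isq s * hnu n s).

Lemma weight1_ge0 s : 0 < s < 1 -> 0 <= weight1 s.
Proof.
move=> s01; apply: mulr_ge0; first by rewrite invr_ge0 ltW// mulr_gt0.
by apply: mulr_ge0; [exact: isq0|apply: mulr_ge0; [exact: mu0|exact: nu0]].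
Qed.

Lemma weight2_ge0 s : 0 < s < 1 -> 0 <= weight2 s.
Proof.
move=> s01; apply: mulr_ge0; first by rewrite invr_ge0 ltW.
by apply: mulr_ge0; [exact: isq0|exact: nu0].
Qed.

Lemma C1on_weight1 : exists d, C1on weight1 d.
Proof.
eexists; exact: (C1onM (C1on_cst (hm n * hp n)^-1)
  (C1onM (@C1on_isq R) (C1onM (C1on_hmu n5) (C1on_hnu n5)))).
Qed.

Lemma C1on_weight2 : exists d, C1on weight2 d.
Proof.
eexists; exact: (C1onM (C1on_cst (hp n)^-1) (C1onM (@C1on_isq R) (C1on_hnu n5))).
Qed.

(** The two constants are [m^2 p^2] and [(n - 1) p^2], matching the two terms of
    [tht = n - 1 + m mu]. *)
Lemma wtot_weights s : (n - 2) ^+ 2 * (n - 4) ^+ 2 / 16 * weight1 s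
  + (n - 1) * (n - 4) ^+ 2 / 4 * weight2 s = wtot n s.
Proof.
rewrite /weight1 /weight2 /wtot /tht.
move: (hmu n s) (hnu n s) (isq s) => mu nu q.
have n2 : n - 2 != 0 by rewrite gt_eqF// subr_gt0 (lt_le_trans _ n5)// ltr_nat.
have n4 : n - 4 != 0 by rewrite gt_eqF// subr_gt0 (lt_le_trans _ n5)// ltr_nat.
by rewrite /hm /hp; field; rewrite n2 n4.
Qed.

Lemma weight2_le_wtot s : 0 < s < 1 ->
  n ^+ 2 * (n - 4) ^+ 2 / 16 * weight2 s <= wtot n s.
Proof.
move=> s01.
rewrite -subr_ge0 (_ : _ - _ = isq s * (hp n * (hm n * (hmu n s - hm n) * hnu n s))).
  apply: mulr_ge0; first exact: isq0.
  apply: mulr_ge0; first exact: ltW.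
  apply: mulr_ge0; last exact: nu0.
  by apply: mulr_ge0; [exact: ltW|rewrite subr_ge0; exact: hmu_ge].
rewrite /weight2 /wtot /tht.
move: (hmu n s) (hnu n s) (isq s) => mu nu q.
have n4 : n - 4 != 0 by rewrite gt_eqF// subr_gt0 (lt_le_trans _ n5)// ltr_nat.
by rewrite /hm /hp; field.
Qed.

(** The cutoff integrals increase with the index, so the [k]-th is at most the [j]-th for large [j],
    whose error [C / j.+2] is arbitrarily small. *)
Lemma cut_integral_wtot_le k :
  cut_integral u (wtot n) k <= Ir (fun x => laplacian u x ^+ 2).
Proof.
have [d wC] := C1on_wtot n5; have [C HC] := Ir_cutoff_bound N5 u4 b1.
have w0 s : 0 < s < 1 -> 0 <= wtot n s.
  move=> s01; apply: mulr_ge0; first exact: isq0.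
  apply: mulr_ge0; first exact: ltW.
  apply: mulr_ge0; last exact: nu0.
  apply: addr_ge0; first by rewrite subr_ge0; apply: le_trans n5; lra.
  by apply: mulr_ge0; [exact: ltW|exact: mu0].
apply/ler_addgt0Pr => e e0; near \oo => j.
apply: (@le_trans _ _ (cut_integral u (wtot n) j)).
  apply: (cut_integral_nd u4 b1 wC w0); near: j; exact: nbhs_infty_ge.
apply: le_trans (HC j) _; rewrite lerD2l ler_pdivrMr ?ltr0n// mulrC -ler_pdivrMr//.
apply: (@le_trans _ _ j%:R); last by rewrite ler_nat -addn2 leq_addr.
by near: j; exact: nbhs_infty_ger.
Unshelve. all: by end_near. Qed.

Lemma integral_B_laplacian :
  integral_B (fun x => laplacian u x ^+ 2) = (Ir (fun x => laplacian u x ^+ 2))%:E.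
Proof.
rewrite -(integralRN_EFin n20 (nice_laplacian2 u4 b1)) /integral_B.
congr integralRN; apply/funext => x; case: ifPn => //.
rewrite enorm_lt1 -leNgt => s1.
have [_ ->] := Cc_laplacian u4; first by rewrite expr0n.
exact: lt_le_trans s1.
Qed.

(** The exponent is shaped for factoring out [|x|^2]: [a = p / 2] gives [N / 2], and [a = m / 2]
    gives [N / 2 + 1]. *)
Lemma enorm_powR x a : 0 < sqn x ->
  enorm x `^ (2 * (1 + a)) = sqn x * sqn x `^ a.
Proof.
move=> s0; rewrite enormE -powR12_sqrt ?(ltW s0)// -powRrM mulrA mulVf// mul1r.
by rewrite powRD ?powRr1 ?(ltW s0)// (gt_eqF s0) implybT.
Qed.

Let den x (c a : R) : 0 < sqn x < 1 -> 0 <= c <= 1 -> 0 < a ->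
  1 - c * sqn x `^ (a / 2) != 0.
Proof. by move=> x01 c01 a0; rewrite gt_eqF// rho_den_gt0. Qed.

Let c01 : (0 : R) <= (9 / 10 : R) <= (1 : R).
Proof. by apply/andP; split; lra. Qed.

Lemma weight2E x : 0 < sqn x < 1 ->
  u x ^+ 2 / (enorm x ^+ 2 * (enorm x ^+ 2 - enorm x `^ (n / 2))) =
  weight2 (sqn x) * u x ^+ 2.
Proof.
move=> x01; have /andP[s0 _] := x01.
have dp : 1 - 1 * sqn x `^ (hp n / 2) != 0 by apply: den => //; rewrite ler01 lexx.
rewrite (_ : n / 2 = 2 * (1 + hp n / 2)); last by rewrite /hp; field.
rewrite enorm_powR// enormE sqr_sqrtr ?sqn_ge0// /weight2 /isq /hnu /rho.
have hp0 : hp n != 0 by rewrite gt_eqF.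
move: dp hp0 s0; move: (sqn x `^ (hp n / 2)) => P.
move: (hp n) (sqn x) (u x) => p s y dp hp0 s0.
have -> : s - s * P = s * (1 - 1 * P) by ring.
move: dp; move: (1 - 1 * P) => d d0.
by field; rewrite d0 hp0 gt_eqF.
Qed.

Lemma weight1E x : 0 < sqn x < 1 ->
  u x ^+ 2 / ((enorm x ^+ 2 - 9 / 10 * enorm x `^ (n / 2 + 1)) *
              (enorm x ^+ 2 - enorm x `^ (n / 2))) =
  weight1 (sqn x) * u x ^+ 2.
Proof.
move=> x01; have /andP[s0 _] := x01.
have dp : 1 - 1 * sqn x `^ (hp n / 2) != 0 by apply: den => //; rewrite ler01 lexx.
have dm : 1 - 9 / 10 * sqn x `^ (hm n / 2) != 0 by apply: den.
rewrite (_ : n / 2 = 2 * (1 + hp n / 2)); last by rewrite /hp; field.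
rewrite (_ : 2 * (1 + hp n / 2) + 1 = 2 * (1 + hm n / 2)); last first.
  by rewrite /hm /hp; field.
rewrite !enorm_powR// enormE sqr_sqrtr ?sqn_ge0// /weight1 /isq /hmu /hnu /rho.
have hp0 : hp n != 0 by rewrite gt_eqF.
have hm0 : hm n != 0 by rewrite gt_eqF.
move: dp dm hp0 hm0 s0.
move: (sqn x `^ (hp n / 2)) (sqn x `^ (hm n / 2)) => P Q.
move: (hp n) (hm n) (sqn x) (u x) => p m s y dp dm hp0 hm0 s0.
have -> : s - 9 / 10 * (s * Q) = s * (1 - 9 / 10 * Q) by ring.
have -> : s - s * P = s * (1 - 1 * P) by ring.
move: dp dm; move: (1 - 1 * P) (1 - 9 / 10 * Q) => d e d0 e0.
by field; rewrite d0 e0 hp0 hm0 gt_eqF.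
Qed.

Let nk w d k : C1on w d ->
  nice 2 (fun x => psi (k.+2%:R ^+ 2 * sqn x) * w (sqn x) * u x ^+ 2).
Proof. by move=> wC; apply: (nice_cutoff_sq u4 b1 _ wC); rewrite exprn_gt0// ltr0n. Qed.

Let enorm0 x : sqn x = 0 -> enorm x = 0.
Proof. by move=> s0; rewrite enormE s0 sqrtr0. Qed.

Lemma hardy_rellich_two_weights :
  ((((n - 2) ^+ 2 * (n - 4) ^+ 2 / 16 : R)%:E *
        integral_B (fun x => (u x ^+ 2 /
          ((enorm x ^+ 2 - 9 / 10 * enorm x `^ (n / 2 + 1)) *
           (enorm x ^+ 2 - enorm x `^ (n / 2))))%R))
   + (((n - 1) * (n - 4) ^+ 2 / 4 : R)%:E *
        integral_B (fun x => (u x ^+ 2 /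
          (enorm x ^+ 2 * (enorm x ^+ 2 - enorm x `^ (n / 2))))%R))
   <= integral_B (fun x => (laplacian u x ^+ 2)%R))%E.
Proof.
have [d1 C1] := C1on_weight1; have [d2 C2] := C1on_weight2.
rewrite integral_B_laplacian.
have n1 : 0 <= n - 1 by rewrite subr_ge0; apply: le_trans n5; lra.
apply: (cvge_combination_le _ _ _ _
  (cut_integral_cvg u4 b1 C1 weight1_ge0 weight1E _)
  (cut_integral_cvg u4 b1 C2 weight2_ge0 weight2E _)).
- by apply: mulr_ge0 => //; apply: mulr_ge0; exact: sqr_ge0.
- by apply: mulr_ge0 => //; apply: mulr_ge0 => //; exact: sqr_ge0.
- by move=> k; exact: (cut_integral_ge0 u4 b1 k weight1_ge0).
- by move=> k; exact: (cut_integral_ge0 u4 b1 k weight2_ge0).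
(* At the origin the denominator is zero, and the convention [0^-1 = 0] makes the quotient [0]. *)
- by move=> x /enorm0 ->; rewrite powR0 ?expr0n ?mulr0 ?subrr ?mul0r ?invr0 ?mulr0.
- by move=> x /enorm0 ->; rewrite expr0n mul0r invr0 mulr0.
move=> k; apply: le_trans (cut_integral_wtot_le k).
rewrite -(Ir_comb _ _ n20 (nk k C1) (nk k C2)) le_eqVlt; apply/orP; left.
by apply/eqP; congr Ir; apply/funext => x; rewrite -wtot_weights; ring.
Qed.

Lemma hardy_rellich_single_weight :
  (((n ^+ 2 * (n - 4) ^+ 2 / 16 : R)%:E *
        integral_B (fun x => (u x ^+ 2 /
          (enorm x ^+ 2 * (enorm x ^+ 2 - enorm x `^ (n / 2))))%R))
   <= integral_B (fun x => (laplacian u x ^+ 2)%R))%E.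
Proof.
have [d2 C2] := C1on_weight2; have [d wC] := C1on_wtot n5.
rewrite integral_B_laplacian.
have G0 x : sqn x = 0 ->
    u x ^+ 2 / (enorm x ^+ 2 * (enorm x ^+ 2 - enorm x `^ (n / 2))) = 0.
  by move=> /enorm0 ->; rewrite expr0n mul0r invr0 mulr0.
have cv := cut_integral_cvg u4 b1 C2 weight2_ge0 weight2E G0.
(* A second copy of the integral with coefficient [0] brings the claim into the form of
   [cvge_combination_le]. *)
rewrite -[leLHS]adde0 -(mul0e (integral_B (fun x =>
  u x ^+ 2 / (enorm x ^+ 2 * (enorm x ^+ 2 - enorm x `^ (n / 2)))))).
apply: (cvge_combination_le _ _ _ _ cv cv) => //.
- by apply: mulr_ge0 => //; apply: mulr_ge0; exact: sqr_ge0.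
- by move=> k; exact: (cut_integral_ge0 u4 b1 k weight2_ge0).
- by move=> k; exact: (cut_integral_ge0 u4 b1 k weight2_ge0).
move=> k; apply: le_trans (cut_integral_wtot_le k).
rewrite -(Ir_comb _ _ n20 (nk k C2) (nk k C2)).
apply: (Ir_le n20 _ (nk k wC)) => [|x].
  apply: niceZD (nk k C2).
  under eq_fun do rewrite -[_ * _]add0r.
  by apply: niceZD (nk k C2); exact: nice0.
rewrite mul0r addr0.
have [x01|x01] := boolP (0 < sqn x < 1); last by rewrite !(cut_outside u4 b1)// mulr0.
rewrite mulrA; apply: ler_wpM2r; first exact: sqr_ge0.
by rewrite mulrCA; apply: ler_wpM2l; [exact: psi_ge0|exact: weight2_le_wtot].
Qed.

End hardy_rellich_inequality.
Theorem mainTheorem1 (R : realType) (N : nat) (hN : (5 <= N)%N)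
  (u : 'rV[R]_N -> R) (hu : Cc_inf_unit_ball u) :
  (integral_B (fun x => (laplacian u x ^+ 2)%R) >=
     (((N%:R - 2) ^+ 2 * (N%:R - 4) ^+ 2 / 16 : R)%:E *
        integral_B (fun x => (u x ^+ 2 /
          ((enorm x ^+ 2 - 9 / 10 * enorm x `^ (N%:R / 2 + 1)) *
           (enorm x ^+ 2 - enorm x `^ (N%:R / 2))))%R))
   + (((N%:R - 1) * (N%:R - 4) ^+ 2 / 4 : R)%:E *
        integral_B (fun x => (u x ^+ 2 /
          (enorm x ^+ 2 * (enorm x ^+ 2 - enorm x `^ (N%:R / 2))))%R)))%E
  /\
  (integral_B (fun x => (laplacian u x ^+ 2)%R) >=
     ((N%:R ^+ 2 * (N%:R - 4) ^+ 2 / 16 : R)%:E *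
        integral_B (fun x => (u x ^+ 2 /
          (enorm x ^+ 2 * (enorm x ^+ 2 - enorm x `^ (N%:R / 2))))%R)))%E.
Proof.
have [us [r [r1 ur]]] := hu.
(* The radius [r] may be negative, so it is replaced by its positive part before squaring. *)
pose b : R := Num.max r 0 ^+ 2.
have b1 : b < 1.
  by rewrite expr_lt1// ?gt_max ?r1 ?ltr01// le_max lexx orbT.
have u4 : Cc 4 b u.
  split; first exact: smooth_Ck.
  move=> x bx; apply: ur; rewrite enormE.
  apply: (@le_trans _ _ (Num.max r 0)); first by rewrite le_max lexx.
  have r0 : 0 <= Num.max r 0 by rewrite le_max lexx orbT.
  by rewrite -[leLHS]ger0_norm// -sqrtr_sqr ler_wsqrtr// ltW.
split; first exact: (hardy_rellich_two_weights hN u4 b1).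
exact: (hardy_rellich_single_weight hN u4 b1).
Qed.
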